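(* There are universal constants $c_1, c_2 > 0$ such that for every $n \in \mathbb{N}$, every $\mathcal{D} \subseteq \{0,1\}^n$ and every function $f : \mathcal{D} \rightarrow \{0,1\}$, $$c_1 \, \mathrm{Adv}^{\pm}(f) \;\leq\; Q(f) \;\leq\; c_2 \, \mathrm{Adv}^{\pm}(f) ,$$ i.e., $Q(f) = \Theta\big(\mathrm{Adv}^{\pm}(f)\big)$, where $Q(f)$ is the bounded-error quantum query complexity of $f$ and $\mathrm{Adv}^{\pm}(f)$ is the general adversary bound of $f$.
   Context: Notation: $[n] = \{1, \ldots, n\}$; $\|\cdot\|$ is the spectral norm of an operator. General adversary bound: for $f : \mathcal{D} \to \{0,1\}$ with $\mathcal{D} \subseteq \{0,1\}^n$, an adversary matrix for $f$ is a real symmetric $|\mathcal{D}| \times |\mathcal{D}|$ matrix $\Gamma$, with rows and columns indexed by $\mathcal{D}$, such that $\Gamma_{x,y} = 0$ for all $x, y \in \mathcal{D}$ with $f(x) = f(y)$. For $j \in [n]$ let $\Delta_j$ be the $\mathcal{D} \times \mathcal{D}$ matrix whose $(x,y)$ entry is $1$ if $x_j \neq y_j$ and $0$ otherwise, and let $\Gamma \circ \Delta_j$ denote the entry-wise product. Then $$\mathrm{Adv}^{\pm}(f) = \max_{\Gamma} \frac{\|\Gamma\|}{\max_{j \in [n]} \|\Gamma \circ \Delta_j\|},$$ the maximum being over all nonzero adversary matrices $\Gamma$ for $f$ (entries may be negative); if $f$ is constant, so that there is no nonzero adversary matrix, $\mathrm{Adv}^{\pm}(f) = 0$. Quantum query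 complexity: on input $x \in \mathcal{D}$ the algorithm has access to the oracle unitary $O_x$ mapping $|i, b\rangle \mapsto |i, x_i \oplus b\rangle$ for $i \in [n]$, $b \in \{0,1\}$. A $T$-query quantum algorithm starts in a fixed state of a finite-dimensional space (query registers tensored with an arbitrary workspace), applies input-independent unitaries interleaved with $T$ applications of $O_x$ (acting as the identity on the workspace), and then performs an input-independent measurement producing an output. $Q(f)$ is the least $T$ such that some $T$-query algorithm outputs $f(x)$ with probability at least $2/3$ for every $x \in \mathcal{D}$. *)

(* Defs.v *)
From HB Require Import structures.
From mathcomp Require Import all_boot all_order all_algebra spectral.
From mathcomp Require Import complex.
From mathcomp Require Import boolp classical_sets reals.

Set Implicit Arguments.
Unset Strict Implicit.
Unset Printing Implicit Defensive.

Import Order.TTheory GRing.Theory Num.Theory.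
Local Open Scope ring_scope.
Local Open Scope complex_scope.
Local Open Scope sesquilinear_scope.
Local Open Scope classical_set_scope.

Definition cube (n : nat) : finType := {ffun 'I_n -> bool}.

Definition domain (n : nat) (D : {set cube n}) : finType := {x : cube n | x \in D}.

Definition sqnorm (K : numDomainType) (d : nat) (v : 'cV[K]_d) : K :=
  \sum_i `|v i 0| ^+ 2.

Section Adversary.
Variable R : realType.

Definition spectral_norm (d : nat) (A : 'M[R]_d) : R :=
  sup [set Num.sqrt (sqnorm (A *m v)) | v in [set v : 'cV[R]_d | sqnorm v <= 1]].

Variables (n : nat) (D : {set cube n}) (f : domain D -> bool).

(* Rows and columns are indexed by D through [enum_val : 'I_#|D| -> D]. *)
Definition adversary_matrix (G : 'M[R]_#|domain D|) : Prop :=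
  G^T = G /\
  forall x y, f (enum_val x) = f (enum_val y) -> G x y = 0.

Definition Delta (j : 'I_n) : 'M[R]_#|domain D| :=
  \matrix_(x < #|domain D|, y < #|domain D|)
    (val (enum_val x) j != val (enum_val y) j)%:R.

Definition adv_ratio (G : 'M[R]_#|domain D|) : R :=
  spectral_norm G /
  \big[Num.max/0]_(j < n) spectral_norm (map2_mx *%R G (Delta j)).

(* The maximum is written as a supremum, finite by [adv_bounded] below; for
   constant f the set is empty and [sup set0 = 0]. *)
Definition Adv : R :=
  sup [set adv_ratio G | G in [set G | adversary_matrix G /\ G != 0]].

End Adversary.

Section Query.
Variables (R : realType) (n : nat).

Definition basis (W : finType) : finType := ('I_n * bool * W)%type.

Definition query (W : finType) (x : cube n) (s : basis W) : basis W :=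
  let: (i, b, w) := s in (i, x i (+) b, w).

(* The operator sending the basis vector indexed by s to the one indexed by
   p s. *)
Definition basis_op (S : finType) (p : S -> S) : 'M[R[i]]_#|S| :=
  \matrix_(k < #|S|, l < #|S|) (enum_val k == p (enum_val l))%:R.

Definition oracle (W : finType) (x : cube n) : 'M[R[i]]_#|basis W| :=
  basis_op (query (W := W) x).

(* [alg_meas b] are measurement operators: on the state psi the outcome b has
   probability |alg_meas b psi|^2.  Two outcomes suffice, since the others can
   be merged. *)
Record query_algorithm := QueryAlgorithm {
  alg_work : finType;
  alg_init : 'cV[R[i]]_#|basis alg_work|;
  alg_unitary : nat -> 'M[R[i]]_#|basis alg_work|;
  alg_meas : bool -> 'M[R[i]]_#|basis alg_work|;
  alg_initP : sqnorm alg_init = 1;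
  alg_unitaryP : forall t, alg_unitary t \is unitarymx;
  alg_measP : \sum_b (alg_meas b)^t* *m alg_meas b = 1%:M
}.

(* U_T O_x U_(T-1) O_x ... U_1 O_x U_0 applied to the initial state: running A
   with T queries uses only its first T + 1 unitaries. *)
Fixpoint final_state (A : query_algorithm) (x : cube n) (T : nat)
    : 'cV[R[i]]_#|basis (alg_work A)| :=
  if T is T'.+1 then
    alg_unitary A T *m (oracle (alg_work A) x *m final_state A x T')
  else alg_unitary A 0 *m alg_init A.

Definition output_prob (A : query_algorithm) (x : cube n) (T : nat) (b : bool)
    : R[i] :=
  sqnorm (alg_meas A b *m final_state A x T).

Variables (D : {set cube n}) (f : domain D -> bool).

Definition computable_with (T : nat) : Prop :=
  exists A : query_algorithm,
    forall x : domain D, 2%:R / 3%:R <= output_prob A (val x) T (f x).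

(* By [computable_with_Q] below, the default value 0 is relevant only for
   n = 0, when the query register is zero-dimensional and f is constant. *)
Definition Q : nat :=
  xget 0%N [set T | computable_with T /\
                    forall T', computable_with T' -> (T <= T')%N].

End Query.

Arguments Adv R {n D} f.
Arguments Q R {n D} f.

Section AdvBounded.
Variable R : realType.

Lemma sqnorm_ge0 (K : numDomainType) d (v : 'cV[K]_d) : 0 <= sqnorm v.
Proof. by apply: sumr_ge0 => i _; rewrite exprn_ge0. Qed.

Lemma sqnorm_ge (d : nat) (v : 'cV[R]_d) i : `|v i 0| ^+ 2 <= sqnorm v.
Proof.
rewrite /sqnorm (bigD1 i) //= lerDl.
by apply: sumr_ge0 => k _; rewrite exprn_ge0.
Qed.

Lemma sqnorm_mul_le d (A : 'M[R]_d) (v : 'cV[R]_d) (a : R) :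
  (forall i j, `|A i j| <= a) -> sqnorm v <= 1 ->
  Num.sqrt (sqnorm (A *m v)) <= Num.sqrt (\sum_(i < d) (d%:R * a) ^+ 2).
Proof.
move=> Aa v1; rewrite ler_sqrt; last by apply: sumr_ge0 => i _; rewrite sqr_ge0.
apply: ler_sum => i _; rewrite ler_sqr ?nnegrE //; last first.
  by rewrite mulr_ge0 // (le_trans _ (Aa i i)).
rewrite mxE (le_trans (ler_norm_sum _ _ _)) //.
have -> : d%:R * a = \sum_(j < d) a by rewrite sumr_const card_ord mulr_natl.
apply: ler_sum => j _; rewrite normrM -[a]mulr1 ler_pM //.
by rewrite -(@ler_pXn2r _ 2) ?nnegrE // expr1n (le_trans (sqnorm_ge v j)).
Qed.

Lemma spectral_has_sup d (A : 'M[R]_d) :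
  has_sup [set Num.sqrt (sqnorm (A *m v)) | v in [set v : 'cV[R]_d | sqnorm v <= 1]].
Proof.
split.
  exists (Num.sqrt (sqnorm (A *m 0))), 0 => //=.
  by rewrite /sqnorm big1 // => i _; rewrite mxE normr0 expr0n.
pose a := \sum_i \sum_j `|A i j|.
exists (Num.sqrt (\sum_(i < d) (d%:R * a) ^+ 2)) => _ [v /= v1 <-].
apply: sqnorm_mul_le => // i j.
rewrite /a (bigD1 i) //= (bigD1 j) //= -addrA lerDl.
by rewrite addr_ge0 // sumr_ge0 // => k _; rewrite sumr_ge0.
Qed.

Lemma spectral_norm_ge d (A : 'M[R]_d) i j : `|A i j| <= spectral_norm A.
Proof.
have [_ ub] := spectral_has_sup A.
apply: le_trans (ub_le_sup ub _); last first.
  exists (delta_mx j 0) => //=; rewrite /sqnorm (bigD1 j) //= mxE !eqxx normr1.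
  by rewrite expr1n big1 ?addr0 // => k /negPf kj; rewrite mxE kj normr0 expr0n.
rewrite -[X in X <= _]sqrtr_sqr ler_sqrt ?sqnorm_ge0 //.
rewrite -real_normK ?num_real //; apply: le_trans (sqnorm_ge _ i).
rewrite mxE (bigD1 j) //= mxE !eqxx mulr1 big1 ?addr0 // => k /negPf kj.
by rewrite mxE kj mulr0.
Qed.

Lemma spectral_norm_le d (A : 'M[R]_d) a : (forall i j, `|A i j| <= a) ->
  spectral_norm A <= Num.sqrt (\sum_(i < d) (d%:R * a) ^+ 2).
Proof.
move=> Aa; apply: ge_sup; first by case: (spectral_has_sup A).
by move=> _ [v /= v1 <-]; exact: sqnorm_mul_le.
Qed.

Lemma adv_bounded n (D : {set cube n}) (f : domain D -> bool) :
  has_ubound [set adv_ratio G |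
              G in [set G : 'M[R]_#|domain D| | adversary_matrix f G /\ G != 0]].
Proof.
set d := #|domain D|.
exists (Num.sqrt (\sum_(i < d) d%:R ^+ 2)) => _ [G /= [[_ Gf] G0] <-].
rewrite /adv_ratio; set m := \big[_/_]_(j < n) _.
have m0 : 0 <= m by rewrite /m; apply: bigmax_ge_id.
have Gm i j : `|G i j| <= m.
  have [fij|fij] := eqVneq (f (enum_val i)) (f (enum_val j)).
    by rewrite Gf // normr0.
  have [k kP] : exists k, val (enum_val i) k != val (enum_val j) k.
    apply/existsP; rewrite -negb_forall; apply/negP => /forallP ij.
    case/eqP: fij; congr f; apply: val_inj; apply/ffunP => k.
    exact/eqP.
  apply: le_trans (le_bigmax _ _ k).
  apply: le_trans (spectral_norm_ge _ i j).
  by rewrite !mxE kP mulr1.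
have m_gt0 : 0 < m.
  rewrite lt_neqAle m0 andbT; apply: contraNneq G0 => m_eq0.
  apply/eqP/matrixP => i j; rewrite mxE; apply/eqP.
  by rewrite -normr_le0 m_eq0.
rewrite ler_pdivrMr // (le_trans (spectral_norm_le Gm)) //.
rewrite [X in Num.sqrt X <= _](_ : _ = (\sum_(i < d) d%:R ^+ 2) * m ^+ 2).
  rewrite sqrtrM; last by apply: sumr_ge0 => i _; rewrite sqr_ge0.
  by rewrite sqrtr_sqr ger0_norm.
by rewrite mulr_suml; apply: eq_bigr => i _; rewrite exprMn.
Qed.

End AdvBounded.

Section QueryExists.
Variables (R : realType) (n : nat).

Definition ket (S : finType) (s : S) : 'cV[R[i]]_#|S| := delta_mx (enum_rank s) 0.

Lemma basis_op_ket (S : finType) (p : S -> S) s :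
  basis_op R p *m ket s = ket (p s).
Proof.
apply/colP => k; rewrite !mxE (bigD1 (enum_rank s)) //= big1 ?addr0 => [|l ls].
  by rewrite !mxE !eqxx mulr1 enum_rankK andbT (can2_eq (@enum_valK _) (@enum_rankK _)).
by rewrite [in X in _ * X]mxE (negPf ls) mulr0.
Qed.

Lemma basis_op_unitary (S : finType) (p q : S -> S) :
  cancel p q -> cancel q p -> basis_op R p \is unitarymx.
Proof.
move=> pK qK; apply/unitarymxP/matrixP => k l.
rewrite !mxE (bigD1 (enum_rank (q (enum_val k)))) //= big1 ?addr0 => [|m mk].
  rewrite !mxE enum_rankK qK eqxx mul1r conjC_nat eq_sym.
  by rewrite (inj_eq (@enum_val_inj _ _)).
rewrite !mxE; case: eqP => [km|]; last by rewrite mul0r.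
by case/eqP: mk; rewrite km pK enum_valK.
Qed.

Lemma computable_exists (D : {set cube n}) (f : domain D -> bool) :
  (0 < n)%N -> exists T, computable_with R f T.
Proof.
move=> n0; pose i0 := Ordinal n0.
pose upd (w : cube n) (i : 'I_n) b : cube n := [ffun k => if k == i then b else w k].
pose swap (i : 'I_n) (s : basis n (cube n)) : bool * cube n :=
  (s.2 i, upd s.2 i s.1.2).
pose step (s : basis n (cube n)) : basis n (cube n) :=
  (ordS s.1.1, (swap s.1.1 s).1, (swap s.1.1 s).2).
pose pets (s : basis n (cube n)) : basis n (cube n) :=
  (ord_pred s.1.1, (swap (ord_pred s.1.1) s).1, (swap (ord_pred s.1.1) s).2).
have updK w i b : upd (upd w i b) i (w i) = w.
  by apply/ffunP => k; rewrite !ffunE; case: eqP => // ->.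
have stepK : cancel step pets.
  by move=> [[i b] w]; rewrite /pets /step /= ordSK updK /upd ffunE eqxx.
have petsK : cancel pets step.
  by move=> [[i b] w]; rewrite /pets /step /= ord_predK updK /upd ffunE eqxx.
pose g (w : cube n) := if insub w is Some y then f y else false.
pose M b : 'M[R[i]]_#|basis n (cube n)| :=
  diag_mx (\row_k (g (enum_val k).2 == b)%:R).
pose z : cube n := [ffun=> false].
have ket1 (S : finType) (s : S) : sqnorm (ket s) = 1.
  rewrite /sqnorm (bigD1 (enum_rank s)) //= !mxE !eqxx normr1 expr1n.
  by rewrite big1 ?addr0 // => k /negPf ks; rewrite mxE ks normr0 expr0n.
have MP : \sum_b (M b)^t* *m M b = 1%:M.
  rewrite big_bool /= /M !tr_diag_mx !map_diag_mx !mulmx_diag.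
  apply/matrixP => k l; rewrite !mxE; case: (k =P l) => _; last by rewrite addr0.
  rewrite !mulr1n !rmorph_nat; case: (g _) => /=.
    by rewrite mulr0 mulr1 addr0.
  by rewrite mulr0 mulr1 add0r.
pose A := @QueryAlgorithm R n (cube n) (ket (ord_pred i0, false, z))
  (fun=> basis_op R step) M (ket1 _ _) (fun=> basis_op_unitary stepK petsK) MP.
pose pos t := iter t (@ordS n) i0.
have posE t : (t < n)%N -> val (pos t) = t.
  elim: t => [//|t IH] tn; rewrite /= -[in LHS]/(pos t) IH ?modn_small //.
  exact: ltnW.
pose run (x : cube n) t : 'cV[R[i]]_#|basis n (cube n)| :=
  iter t (fun v => basis_op R step *m (basis_op R (query x) *m v))
    (basis_op R step *m ket (ord_pred i0, false, z)).
have runE (x : cube n) t : (t <= n)%N ->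
    run x t = ket (pos t, false, [ffun k : 'I_n => (k < t)%N && x k]).
  elim: t => [_|t IH tn].
    rewrite /run /= basis_op_ket /step /= ord_predK ffunE; congr (ket (_, _, _)).
    by apply/ffunP => k; rewrite !ffunE; case: eqP.
  rewrite /run iterS -/(run x t) IH ?(ltnW tn) // !basis_op_ket.
  have pt : nat_of_ord (pos t) = t by exact: posE.
  rewrite /step /query /swap /= !ffunE pt ltnn.
  congr (ket (_, _, _)); apply/ffunP => k; rewrite !ffunE addbF.
  have [->|kt] := eqVneq k (pos t); first by rewrite pt ltnSn.
  rewrite [in RHS]ltnS [in RHS]leq_eqVlt; case: eqP => // k_t.
  by case/eqP: kt; apply: val_inj; exact: etrans k_t (esym pt).
have stateE (x : cube n) t : final_state A x t = run x t.
  by elim: t => [//|t IH]; rewrite /run iterS -/(run x t) -IH.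
exists n, A => x; rewrite /output_prob stateE runE //.
have -> : [ffun k : 'I_n => (k < n)%N && val x k] = val x.
  by apply/ffunP => k; rewrite ffunE ltn_ord.
rewrite /sqnorm (bigD1 (enum_rank (pos n, false, val x))) //=.
rewrite mul_diag_mx !mxE enum_rankK /= /g valK !eqxx mulr1 normr1 expr1n.
rewrite -[leLHS]addr0 lerD //; last by apply: sumr_ge0 => k _; rewrite exprn_ge0.
by rewrite ler_pdivrMr ?ltr0n // mul1r ler_nat.
Qed.

Lemma computable_with_Q (D : {set cube n}) (f : domain D -> bool) :
  (0 < n)%N -> computable_with R f (Q R f).
Proof.
move=> n0; have : exists T, `[< computable_with R f T >].
  by have [T fT] := computable_exists f n0; exists T; apply/asboolP.
move=> ex; rewrite /Q; case: xgetP => [T _ []//|].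
case: (ex_minnP ex) => T /asboolP fT Tmin /(_ T) [] /=; split=> // T' fT'.
by apply: Tmin; apply/asboolP.
Qed.

End QueryExists.

(* Main.v *)
Require Import Defs.
From mathcomp Require Import all_boot all_order all_algebra spectral.
From mathcomp Require Import complex.
From mathcomp Require Import boolp classical_sets reals.
From mathcomp Require Import ring lra.

(** Lower bound: for an adversary matrix G and vectors a, b, the sum of
    G x y * a x * b y * <psi_x, psi_y> over all x, y, where psi_x is the state
    reached on input x, starts at a^T G b, changes by at most
    max_j |G o Delta_j| (|a|^2 + |b|^2) per query, and ends below
    17/36 |G| (|a|^2 + |b|^2), because the final states of inputs with different
    values are distinguished with probability 2/3.

    Upper bound: a Hahn-Banach argument turns the adversary bound A into vectors
    u_(x,j) with sum_j |u_(x,j)|^2 <= 2 A and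
    sum_(j | x_j <> y_j) <u_(x,j), u_(y,j)> = 1 whenever f x <> f y.  The
    algorithm averages the powers U^t, t < T, of a product U of two reflections,
    applied to a vector e: a fixed point of U with large overlap with e
    makes it accept when f x = 1, while for f x = 0 one has e = psi - U psi, so
    that the average is (psi - U^T psi) / T and is small once T is of order A. *)

Set Implicit Arguments.
Unset Strict Implicit.
Unset Printing Implicit Defensive.

Import Order.TTheory GRing.Theory Num.Theory.
Local Open Scope ring_scope.

(** * The spectral norm as the best constant in a bilinear bound *)

Section SpectralNorm.
Variable R : realType.

Lemma sqnormE d (v : 'cV[R]_d) : sqnorm v = \sum_i v i 0 ^+ 2.
Proof. by apply: eq_bigr => i _; rewrite real_normK ?num_real. Qed.

Lemma spectral_norm_ge0 d (A : 'M[R]_d) : 0 <= spectral_norm A.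
Proof.
have [_ ub] := spectral_has_sup A.
apply: le_trans (ub_le_sup ub _); last first.
  exists 0 => //=; rewrite /sqnorm big1 ?ler01 // => i _.
  by rewrite mxE normr0 expr0n.
exact: sqrtr_ge0.
Qed.

Lemma sqnorm_mul d (A : 'M[R]_d) (v : 'cV[R]_d) :
  sqnorm (A *m v) <= spectral_norm A ^+ 2 * sqnorm v.
Proof.
have sqZ (c : R) (w : 'cV[R]_d) : sqnorm (c *: w) = c ^+ 2 * sqnorm w.
  by rewrite !sqnormE mulr_sumr; apply: eq_bigr => i _; rewrite mxE exprMn.
have [v0|v0] := eqVneq (sqnorm v) 0.
  have -> : v = 0.
    apply/colP => i; rewrite mxE; apply/eqP; rewrite -normr_eq0 -sqrf_eq0.
    by rewrite eq_le exprn_ge0 // -v0 sqnorm_ge.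
  by rewrite mulmx0 -(scale0r (0 : 'cV[R]_d)) !sqZ expr0n /= !mul0r mulr0.
have vgt0 : 0 < sqnorm v by rewrite lt_neqAle eq_sym v0 sqnorm_ge0.
have [_ ub] := spectral_has_sup A.
set s := Num.sqrt (sqnorm v); have s0 : 0 < s by rewrite sqrtr_gt0.
have ss : s ^+ 2 = sqnorm v by rewrite sqr_sqrtr ?ltW.
have /(ub_le_sup ub) : [set Num.sqrt (sqnorm (A *m v)) |
    v in [set v : 'cV[R]_d | sqnorm v <= 1]]%classic
    (Num.sqrt (sqnorm (A *m (s^-1 *: v)))).
  by exists (s^-1 *: v) => //=; rewrite sqZ exprVn ss mulVf.
rewrite -scalemxAr sqZ -/(spectral_norm A) => /(lerXn2r 2).
rewrite !nnegrE sqrtr_ge0 spectral_norm_ge0 => /(_ isT isT).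
rewrite sqr_sqrtr; last by rewrite mulr_ge0 ?sqr_ge0 ?sqnorm_ge0.
rewrite exprVn ss mulrC.
by rewrite ler_pdivrMr.
Qed.

(** Cauchy-Schwarz combined with the arithmetic-geometric mean inequality, in a form that can be
    summed over families of vectors. Completing the square divides by [L], hence the separate case
    [L = 0]. *)
Lemma bilinear_le_spectral_norm d (A : 'M[R]_d) (a b : 'I_d -> R) :
  \sum_x \sum_y A x y * (a x * b y) <=
  spectral_norm A / 2%:R * (\sum_x a x ^+ 2 + \sum_x b x ^+ 2).
Proof.
set L := spectral_norm A; pose v : 'cV[R]_d := \col_i b i.
have L0 : 0 <= L := spectral_norm_ge0 A.
have Av : \sum_x (A *m v) x 0 ^+ 2 <= L ^+ 2 * \sum_x b x ^+ 2.
  have := sqnorm_mul A v; rewrite !sqnormE -/L.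
  by under [X in _ <= _ * X]eq_bigr do rewrite mxE.
have -> : \sum_x \sum_y A x y * (a x * b y) = \sum_x a x * (A *m v) x 0.
  apply: eq_bigr => x _; rewrite mxE mulr_sumr; apply: eq_bigr => y _.
  by rewrite mxE mulrCA.
have [L_0|L_n0] := eqVneq L 0.
  rewrite L_0 expr0n /= !mul0r in Av *; rewrite big1 // => x _.
  have /eqP : \sum_x (A *m v) x 0 ^+ 2 = 0.
    by apply/eqP; rewrite eq_le Av sumr_ge0 // => i _; rewrite sqr_ge0.
  rewrite psumr_eq0 => [/allP /(_ x (mem_index_enum _))|i _]; last exact: sqr_ge0.
  by rewrite sqrf_eq0 => /eqP ->; rewrite mulr0.
have Lgt0 : 0 < L by rewrite lt_neqAle eq_sym L_n0.
apply: (@le_trans _ _ (\sum_x (L / 2%:R * a x ^+ 2 +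
    (2%:R * L)^-1 * (A *m v) x 0 ^+ 2))).
  apply: ler_sum => x _; set z := (A *m v) x 0.
  have -> : L / 2%:R * a x ^+ 2 + (2%:R * L)^-1 * z ^+ 2 =
    a x * z + (2%:R * L)^-1 * (L * a x - z) ^+ 2 by field.
  by rewrite lerDl mulr_ge0 ?sqr_ge0 // invr_ge0 mulr_ge0.
rewrite big_split /= -!mulr_sumr mulrDr lerD2l.
have -> : L / 2%:R = (2%:R * L)^-1 * L ^+ 2 by field.
by rewrite -mulrA ler_wpM2l // invr_ge0 mulr_ge0.
Qed.

(** With [a = s A v], [b = v] and [N = |A v|^2], the hypothesis reads [s N <= c/2 (s^2 N + 1)]; the
    choice [s = c^-1] gives [N <= c^2]. *)
Lemma spectral_norm_le_bilinear d (A : 'M[R]_d) (c : R) : 0 <= c ->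
  (forall a b : 'I_d -> R, \sum_x \sum_y A x y * (a x * b y) <=
     c / 2%:R * (\sum_x a x ^+ 2 + \sum_x b x ^+ 2)) ->
  spectral_norm A <= c.
Proof.
move=> c0 H; apply: ge_sup; first by case: (spectral_has_sup A).
move=> _ [v /= v1 <-]; rewrite -(ger0_norm c0) -sqrtr_sqr ler_wsqrtr // sqnormE.
set N := \sum_i _; rewrite sqnormE in v1.
have key (s : R) : s * N <= c / 2%:R * (s ^+ 2 * N + 1).
  have := H (fun x => s * (A *m v) x 0) (fun x => v x 0).
  have -> : \sum_x \sum_y A x y * (s * (A *m v) x 0 * v y 0) = s * N.
    rewrite mulr_sumr; apply: eq_bigr => x _.
    rewrite expr2 {3}mxE mulrA mulr_sumr; apply: eq_bigr => y _.
    by rewrite mulrCA.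
  move=> /le_trans; apply; apply: ler_wpM2l; first by rewrite divr_ge0.
  rewrite lerD // mulr_sumr; apply: ler_sum => x _; by rewrite exprMn.
have [c_0|c_n0] := eqVneq c 0.
  by have := key 1; rewrite c_0 !mul0r mul1r expr0n.
have cgt0 : 0 < c by rewrite lt_neqAle eq_sym c_n0.
have := key c^-1.
have -> : c / 2%:R * (c^-1 ^+ 2 * N + 1) = c^-1 * N / 2%:R + c / 2%:R by field.
move=> h; have {}h : c^-1 * N <= c by lra.
by rewrite expr2 -ler_pdivrMl.
Qed.

End SpectralNorm.

(** * A Hahn-Banach theorem along finitely many vectors *)

Section HahnBanach.
Variables (R : realType) (V : lmodType R).
Implicit Types (p q : V -> R) (v w e : V).

Definition sublinear p :=
  (forall v w, p (v + w) <= p v + p w) /\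
  (forall c v, 0 < c -> p (c *: v) = c * p v).

Lemma sublinear0 p : sublinear p -> p 0 = 0.
Proof. by move=> [_ /(_ 2%:R 0)]; rewrite scaler0 ltr0n => /(_ isT); lra. Qed.

Lemma sublinear_opp p v : sublinear p -> - p (- v) <= p v.
Proof.
by move=> sp; have := sp.1 v (- v); rewrite subrr sublinear0 //; lra.
Qed.

Local Open Scope classical_set_scope.

(* Lowers p to a sublinear function that is linear along e; iterating over a
   basis yields a linear minorant with a prescribed value of p. *)
Definition straighten p e v : R :=
  inf [set p (v + t *: e) - t * p e | t in [set t | 0 <= t]].

Lemma straighten_lb p e v : sublinear p ->
  lbound [set p (v + t *: e) - t * p e | t in [set t | 0 <= t]] (- p (- v)).
Proof.
move=> sp _ [t /= t0 <-].
have -> : t * p e = p (t *: e).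
  move: t0; rewrite le_eqVlt => /orP[/eqP <-|t0]; last by rewrite sp.2.
  by rewrite mul0r scale0r sublinear0.
have := sp.1 (v + t *: e) (- v); rewrite addrAC subrr add0r; lra.
Qed.

Lemma straighten_le p e v t : sublinear p -> 0 <= t ->
  straighten p e v <= p (v + t *: e) - t * p e.
Proof.
move=> sp t0; apply: ge_inf; last by exists t.
by exists (- p (- v)); exact: straighten_lb.
Qed.

Lemma le_straighten p e v c : sublinear p ->
  (forall t, 0 <= t -> c <= p (v + t *: e) - t * p e) -> c <= straighten p e v.
Proof.
move=> sp H; apply: lb_le_inf => [|_ [t /= t0 <-]]; last exact: H.
by exists (p (v + 0 *: e) - 0 * p e), 0 => /=.
Qed.

(** Shifts [s] for [v] and [t] for [w] combine to the admissible shift [s + t] for [v + w], and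
    scaling a vector by [c] scales its shifts by [c]. *)
Lemma straighten_sublinear p e : sublinear p -> sublinear (straighten p e).
Proof.
move=> sp.
have addn v w : straighten p e (v + w) <= straighten p e v + straighten p e w.
  rewrite -lerBlDl; apply: le_straighten => // t t0.
  rewrite lerBlDl -lerBlDr; apply: le_straighten => // s s0.
  rewrite lerBlDr; have := straighten_le e (v + w) sp (addr_ge0 s0 t0).
  move/le_trans; apply.
  have := sp.1 (v + s *: e) (w + t *: e).
  by rewrite addrACA -scalerDl; lra.
have scl (c : R) v : 0 < c -> c * straighten p e v <= straighten p e (c *: v).
  move=> c0; apply: le_straighten => // t t0.
  have t'0 : 0 <= t / c by rewrite divr_ge0 // ltW.
  have := straighten_le e v sp t'0; rewrite -(ler_pM2l c0) => /le_trans; apply.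
  rewrite mulrBr -(sp.2 c) // scalerDr scalerA (mulrA c (t / c)).
  by rewrite [c * (t / c)]mulrC divfK // gt_eqF.
split=> // c v c0; apply/eqP; rewrite eq_le scl // andbT.
have cV : 0 < c^-1 by rewrite invr_gt0.
have := scl c^-1 (c *: v) cV; rewrite scalerA mulVf ?gt_eqF // scale1r.
by rewrite ler_pdivrMl.
Qed.

Lemma straighten_linear p e : sublinear p ->
  [/\ forall v, straighten p e v <= p v, straighten p e e = p e &
      straighten p e (- e) = - straighten p e e].
Proof.
move=> sp; have sq := straighten_sublinear e sp.
have le v : straighten p e v <= p v.
  by have := straighten_le e v sp (lexx 0); rewrite scale0r mul0r addr0 subr0.
have := straighten_le e (- e) sp ler01.
rewrite scale1r addNr sublinear0 // mul1r sub0r => h.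
have := sublinear_opp e sq; have := le e => h1 h2.
by split=> //; lra.
Qed.

(** The value [q v] is squeezed by [- q (- v) <= q v] and [q (- v) <= - p v]. Hence later
    straightenings keep the values fixed by earlier ones. *)
Lemma sublinear_linear_le p q v : sublinear q -> (forall w, q w <= p w) ->
  p (- v) = - p v -> q v = p v /\ q (- v) = - q v.
Proof.
move=> sq qp pv; have := sublinear_opp v sq; have := qp v; have := qp (- v).
by rewrite pv; split; lra.
Qed.

Lemma sublinear_straighten_seq p (s : seq V) : sublinear p ->
  exists q, [/\ sublinear q, forall v, q v <= p v &
    {in s, forall v, q (- v) = - q v}].
Proof.
elim: s p => [|e s IH] p sp; first by exists p; split.
have [le _ lin] := straighten_linear e sp.
have [q [sq qp qs]] := IH _ (straighten_sublinear e sp).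
exists q; split=> // [v|v]; first exact: le_trans (qp v) (le v).
rewrite inE => /orP[/eqP ->|/qs //].
by have [_ ->] := sublinear_linear_le sq qp lin.
Qed.

(** Straightening along [e] first pins the value [p e]; straightening along the list then preserves
    it. A list is enough in finite dimension, where [s] is taken to be a basis. *)
Lemma hahn_banach p e (s : seq V) : sublinear p ->
  exists q, [/\ sublinear q, forall v, q v <= p v, q e = p e &
    {in e :: s, forall v, q (- v) = - q v}].
Proof.
move=> sp; have [le ee lin] := straighten_linear e sp.
have [q [sq qp qs]] := sublinear_straighten_seq (e :: s) (straighten_sublinear e sp).
have [qe _] := sublinear_linear_le sq qp lin.
by exists q; split=> // [v|]; [exact: le_trans (qp v) (le v) | rewrite qe].
Qed.

Lemma sublinear_sum q (I : finType) (F : I -> V) (c : I -> R) :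
  sublinear q -> (forall i, q (- F i) = - q (F i)) ->
  q (\sum_i c i *: F i) = \sum_i c i * q (F i).
Proof.
move=> sq lin.
have lin2 v w : q (- v) = - q v -> q (- w) = - q w -> q (v + w) = q v + q w.
  move=> qv qw; apply/eqP; rewrite eq_le sq.1 /=.
  have := sq.1 (v + w) (- w); rewrite addrK qw; lra.
have linD v w : q (- v) = - q v -> q (- w) = - q w -> q (- (v + w)) = - q (v + w).
  by move=> qv qw; rewrite opprD !lin2 ?opprK ?qv ?qw ?opprK //; lra.
have linZ i : q (c i *: F i) = c i * q (F i) /\ q (- (c i *: F i)) = - (c i * q (F i)).
  have [ci|ci|->] := ltgtP (c i) 0; last first.
  - by rewrite scale0r oppr0 sublinear0 // mul0r oppr0.
  - by rewrite -scalerN !sq.2 // lin mulrN.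
  have mc : 0 < - c i by rewrite oppr_gt0.
  rewrite -scaleNr -[c i *: F i]opprK -scaleNr -scalerN !sq.2 // lin.
  by rewrite mulrNN mulNr.
suff [] : q (\sum_i c i *: F i) = \sum_i c i * q (F i) /\
   q (- (\sum_i c i *: F i)) = - q (\sum_i c i *: F i) by [].
elim/big_rec2: _ => [|i y v _ [IH1 IH2]]; first by rewrite oppr0 sublinear0 // oppr0.
have [l1 l2] := linZ i.
have lz : q (- (c i *: F i)) = - q (c i *: F i) by rewrite l2 l1.
by rewrite linD // lin2 // l1 IH1.
Qed.

End HahnBanach.

(** * Duality between the adversary bound and families of vectors *)

Section Duality.
Variables (R : realType) (n : nat) (D : {set cube n}) (f : domain D -> bool).

Local Notation d := #|domain D|.
Local Notation fv x := (f (enum_val x)).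

Definition bit (x : 'I_d) (j : 'I_n) : bool := val (enum_val x) j.

Lemma bit_neq (x y : 'I_d) : fv x != fv y -> exists j, bit x j != bit y j.
Proof.
move=> fxy; apply/existsP; rewrite -negb_forall.
apply: contraNN fxy => /forallP xy; apply/eqP; congr f; apply: val_inj.
by apply/ffunP => k; apply/eqP/xy.
Qed.

(* The constraints of the dual program, with the value 1 of each inner product
   relaxed to M x y and the common bound t on the squared norms shifted by b. *)
Definition dual_feasible (M : 'M[R]_d) (b : 'rV[R]_d) (t : R) : Prop :=
  exists (K : finType) (u : 'I_d -> 'I_n -> K -> R),
    (forall x y : 'I_d, fv x -> ~~ fv y ->
       \sum_j \sum_k (bit x j != bit y j)%:R * (u x j k * u y j k) = M x y) /\
    (forall x, \sum_j \sum_k u x j k ^+ 2 <= b 0 x + t).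

Definition dual_value (M : 'M[R]_d) (b : 'rV[R]_d) : R :=
  inf [set t | dual_feasible M b t]%classic.

Lemma dual_feasible_ge M b t x : dual_feasible M b t -> - b 0 x <= t.
Proof.
case=> K [u [_ /(_ x) h]]; have : 0 <= b 0 x + t; last by lra.
by apply: le_trans h; do 2!(apply: sumr_ge0 => ? _); exact: sqr_ge0.
Qed.

(** Concatenating two families of vectors adds their inner products and their squared norms. *)
Lemma dual_feasibleD M b t M' b' t' : dual_feasible M b t ->
  dual_feasible M' b' t' -> dual_feasible (M + M') (b + b') (t + t').
Proof.
case=> K [u [uM ub]] [K' [u' [uM' ub']]]; exists (K + K')%type.
exists (fun x j k => match k with inl k => u x j k | inr k => u' x j k end).
split=> [x y fx fy|x]; rewrite mxE.
  rewrite -uM // -uM' // -big_split; apply: eq_bigr => j _ /=.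
  by rewrite big_sumType.
rewrite addrACA; apply: le_trans (lerD (ub x) (ub' x)).
by rewrite -big_split /=; apply: ler_sum => j _; rewrite big_sumType.
Qed.

Lemma dual_feasibleZ c M b t : 0 < c -> dual_feasible M b t ->
  dual_feasible (c *: M) (c *: b) (c * t).
Proof.
move=> c0 [K [u [uM ub]]]; exists K, (fun x j k => Num.sqrt c * u x j k).
have cc : Num.sqrt c ^+ 2 = c by rewrite sqr_sqrtr // ltW.
split=> [x y fx fy|x]; rewrite mxE.
  rewrite -uM // mulr_sumr; apply: eq_bigr => j _; rewrite mulr_sumr.
  by apply: eq_bigr => k _; rewrite -[in RHS]cc; ring.
rewrite -mulrDr; apply: le_trans (_ : _ <= c * \sum_j \sum_k u x j k ^+ 2) _.
  rewrite mulr_sumr; apply: ler_sum => j _; rewrite mulr_sumr.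
  by apply: ler_sum => k _; rewrite exprMn cc.
by rewrite ler_pM2l.
Qed.

(** Each pair of a positive [x] and a negative [y] gets a private coordinate, placed at one index
    where the inputs differ: [x] holds [M x y] there and [y] holds 1. *)
Lemma dual_feasible_ex M b : exists t, dual_feasible M b t.
Proof.
pose J (x y : 'I_d) := [pick j | bit x j != bit y j].
pose u (x : 'I_d) (j : 'I_n) (k : 'I_d * 'I_d) : R :=
  if [&& fv k.1, ~~ fv k.2 & J k.1 k.2 == Some j] then
    (x == k.1)%:R * M k.1 k.2 + (x == k.2)%:R else 0.
pose B x := \sum_j \sum_k u x j k ^+ 2.
exists (\sum_x `|B x - b 0 x|), ('I_d * 'I_d)%type, u; split=> [x y fx fy|x].
  have xy : x != y by apply: contraNneq fy => <-.
  have [j0 J0] : exists j0, J x y = Some j0.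
    rewrite /J; case: pickP => [j _|none]; first by exists j.
    have [|j] := @bit_neq x y; first by rewrite fx (negPf fy).
    by rewrite none.
  rewrite (bigD1 j0) //= (bigD1 (x, y)) //= big1 ?addr0 => [|[x' y'] kxy].
    have yx : y != x by rewrite eq_sym.
    rewrite /u /= fx fy J0 !eqxx (negPf xy) (negPf yx) /=.
    have -> : bit x j0 != bit y j0.
      by move: J0; rewrite /J; case: pickP => // j jP [<-].
    rewrite big1 => [|j jj0]; first by rewrite /=; ring.
    rewrite big1 // => -[x' y'] _; rewrite /u /=.
    case: ifP => [/and3P[fx' fy' /eqP Jj]|]; last by rewrite !mulr0.
    have -> : x == y' = false by apply: contraNF fy' => /eqP <-.
    have -> : y == x' = false by apply: contraNF fy => /eqP ->.
    case: (x =P x') => [xx'|]; last by move=> _ /=; ring.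
    case: (y =P y') => [yy'|]; last by move=> _ /=; ring.
    by case/eqP: jj0; move: Jj; rewrite -xx' -yy' J0 => -[].
  rewrite /u /=.
  case: ifP => [/and3P[fx' fy' _]|]; last by rewrite !mulr0.
  have -> : x == y' = false by apply: contraNF fy' => /eqP <-.
  have -> : y == x' = false by apply: contraNF fy => /eqP ->.
  move: kxy; rewrite xpair_eqE (eq_sym x') (eq_sym y').
  by case: (x == x'); case: (y == y') => //= _; ring.
rewrite -/(B x) (bigD1 x) //=.
have : 0 <= \sum_(i < d | i != x) `|B i - b 0 i| by apply: sumr_ge0.
have := ler_norm (B x - b 0 x); lra.
Qed.

Variable x0 : 'I_d.

(** The point [x0] supplies the lower bound [- b 0 x0] of the feasible values, so that the infimum
    is a genuine one. *)
Lemma dual_value_le M b t : dual_feasible M b t -> dual_value M b <= t.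
Proof.
move=> h; apply: ge_inf => //; exists (- b 0 x0) => s /=.
exact: dual_feasible_ge.
Qed.

Lemma le_dual_value M b c : (forall t, dual_feasible M b t -> c <= t) ->
  c <= dual_value M b.
Proof. by move=> h; apply: lb_le_inf => //; exact: dual_feasible_ex. Qed.

Lemma dual_value_sublinear :
  sublinear (fun v : 'M[R]_d * 'rV[R]_d => dual_value v.1 v.2).
Proof.
split=> [[M b] [M' b'] /=|].
  rewrite -lerBlDl; apply: le_dual_value => t h.
  rewrite lerBlDl -lerBlDr; apply: le_dual_value => s h'.
  by rewrite lerBlDr; apply: dual_value_le; exact: dual_feasibleD.
have scl c (M : 'M[R]_d) b : 0 < c ->
    dual_value (c *: M) (c *: b) <= c * dual_value M b.
  move=> c0; rewrite -ler_pdivrMl //; apply: le_dual_value => t h.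
  by rewrite ler_pdivrMl //; apply: dual_value_le; exact: dual_feasibleZ.
move=> c [M b] c0 /=; apply/eqP; rewrite eq_le scl //=.
have cV : 0 < c^-1 by rewrite invr_gt0.
have := scl c^-1 (c *: M) (c *: b) cV.
by rewrite !scalerA mulVf ?gt_eqF // !scale1r ler_pdivlMl.
Qed.

Lemma dual_value1_ge1 (x y : 'I_d) : fv x -> ~~ fv y -> 1 <= dual_value (const_mx 1) 0.
Proof.
move=> fx fy; apply: le_dual_value => t [K [u [/(_ x y fx fy) uM ub]]].
move: uM; rewrite mxE => uM.
have h : 2%:R <= \sum_j \sum_k u x j k ^+ 2 + \sum_j \sum_k u y j k ^+ 2.
  rewrite -[X in X <= _]mulr1 -[X in _ * X <= _]uM mulr_sumr -big_split /=.
  apply: ler_sum => j _; rewrite mulr_sumr -big_split /=; apply: ler_sum => k _.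
  set a := u x j k; set c := u y j k; case: (_ != _) => /=.
    have := sqr_ge0 (a - c); rewrite sqrrB; lra.
  have := sqr_ge0 a; have := sqr_ge0 c; lra.
have := ub x; have := ub y; rewrite !mxE; lra.
Qed.

(** A Hahn-Banach minorant [q] of the dual value, touching it at the all-ones matrix with zero
    shift, is determined by its coefficients: [G] collects those on [M] and [w] the negated ones on
    [b]. Each property results from bounding the dual value at a test pair. *)
Lemma dual_multipliers : exists (G : 'M[R]_d) (w : 'I_d -> R),
  [/\ forall x, 0 <= w x, \sum_x w x <= 1,
      \sum_x \sum_(y | fv x && ~~ fv y) G x y = dual_value (const_mx 1) 0 &
      forall (j : 'I_n) (a : 'I_d -> R),
        \sum_x \sum_(y | fv x && ~~ fv y)
           G x y * (bit x j != bit y j)%:R * (a x * a y) <= \sum_x w x * a x ^+ 2].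
Proof.
pose EM (k : 'I_d * 'I_d) : 'M[R]_d * 'rV[R]_d := (delta_mx k.1 k.2, 0).
pose Eb (x : 'I_d) : 'M[R]_d * 'rV[R]_d := (0, delta_mx 0 x).
pose e : 'M[R]_d * 'rV[R]_d := (const_mx 1, 0).
have [q [sq qp qe lin]] := hahn_banach e
  ([seq EM k | k <- enum (('I_d * 'I_d)%type : finType)] ++ [seq Eb x | x <- enum 'I_d])
  dual_value_sublinear.
have linM k : q (- EM k) = - q (EM k).
  by apply: lin; rewrite inE mem_cat map_f ?mem_enum ?orbT.
have linb x : q (- Eb x) = - q (Eb x).
  by apply: lin; rewrite inE mem_cat map_f ?mem_enum ?orbT // [X in _ || X]orbC orbT.
pose G := \matrix_(x, y) q (EM (x, y)); pose w x := - q (Eb x).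
have qM (M : 'M[R]_d) : q (M, 0) = \sum_x \sum_y M x y * G x y.
  have := sublinear_sum (fun k => M k.1 k.2) sq linM.
  have -> : \sum_k M k.1 k.2 *: EM k = (M, 0).
    rewrite -(pair_bigA _ (fun x y => M x y *: EM (x, y))) /=.
    apply: injective_projections => /=; rewrite !raddf_sum /=.
      rewrite [RHS]matrix_sum_delta; apply: eq_bigr => x _.
      by rewrite raddf_sum; apply: eq_bigr => y _.
    rewrite big1 // => x _; rewrite raddf_sum big1 // => y _ /=.
    by rewrite scaler0.
  move=> ->; rewrite -(pair_bigA _ (fun x y => M x y * q (EM (x, y)))) /=.
  by do 2!(apply: eq_bigr => ? _); rewrite mxE.
have qb (b : 'rV[R]_d) : q (0, b) = - \sum_x b 0 x * w x.
  have := sublinear_sum (fun x => b 0 x) sq linb.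
  have -> : \sum_x b 0 x *: Eb x = (0, b).
    apply: injective_projections => /=; rewrite !raddf_sum /=.
      by rewrite big1 // => x _; rewrite scaler0.
    by rewrite [RHS]row_sum_delta.
  by move=> ->; rewrite -sumrN; apply: eq_bigr => x _; rewrite /w mulrN opprK.
have zero (M : 'M[R]_d) (b : 'rV[R]_d) t :
    (forall x y : 'I_d, fv x -> ~~ fv y -> M x y = 0) ->
    (forall x, 0 <= b 0 x + t) -> dual_feasible M b t.
  move=> M0 bt; exists unit, (fun _ _ _ => 0); split=> [x y fx fy|x].
    by rewrite M0 // !big1 // => j _; rewrite big1 // => k _; rewrite !mulr0.
  by rewrite big1 // => j _; rewrite big1 // => k _; rewrite expr0n.
(* Entries outside the positive-negative pairs do not enter feasibility, so zero vectors are
   feasible for every multiple [c]; taking [c = 1] and [c = - 1] makes [G] vanish there. *)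
have z0 x y : ~~ (fv x && ~~ fv y) -> forall c, q (c *: EM (x, y)) <= 0.
  move=> fxy c; apply: le_trans (qp _) _; apply/dual_value_le/zero => [x' y' fx' fy'|z].
    rewrite !mxE; case: eqP => [xx|]; last by rewrite mulr0.
    case: eqP => [yy|]; last by rewrite mulr0.
    by move: fxy; rewrite -[x]xx -[y]yy fx' fy'.
  by rewrite addr0 !mxE mulr0.
have G0 x y : ~~ (fv x && ~~ fv y) -> G x y = 0.
  move=> fxy; apply/eqP; rewrite mxE eq_le; have := z0 _ _ fxy 1.
  have := z0 _ _ fxy (- 1); rewrite scaleN1r scale1r linM oppr_le0.
  by move=> -> ->.
have restr (M : 'M[R]_d) : q (M, 0) = \sum_x \sum_(y | fv x && ~~ fv y) G x y * M x y.
  rewrite qM; apply: eq_bigr => x _; rewrite [RHS]big_mkcond; apply: eq_bigr => y _.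
  by case: ifPn => [_|/G0 ->]; rewrite ?mulr0 // mulrC.
exists G, w; split.
- move=> x; rewrite oppr_ge0; apply: le_trans (qp _) _.
  apply/dual_value_le/zero => [*|y].
    by rewrite mxE.
  by rewrite addr0 mxE ler0n.
- have := qb (- const_mx 1).
  have -> : - \sum_x (- const_mx 1 : 'rV[R]_d) 0 x * w x = \sum_x w x.
    by rewrite -sumrN; apply: eq_bigr => x _; rewrite !mxE mulN1r opprK.
  move=> <-; apply: le_trans (qp _) _; apply/dual_value_le/zero => [*|y].
    by rewrite mxE.
  by rewrite !mxE addNr.
- rewrite -[RHS]qe restr; apply: eq_bigr => x _; apply: eq_bigr => y _.
  by rewrite [X in _ * X]mxE mulr1.
move=> j a.
(* The one-dimensional vectors [a x], supported at index [j], are feasible for this pair with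
   [t = 0]. *)
pose M : 'M[R]_d := \matrix_(x, y) ((bit x j != bit y j)%:R * (a x * a y)).
pose b : 'rV[R]_d := \row_x a x ^+ 2.
have : q (M, b) <= 0.
  apply: le_trans (qp _) _; apply: dual_value_le.
  exists 'I_1, (fun x j' _ => if j' == j then a x else 0); split=> [x y _ _|x].
    rewrite (bigD1 j) //= big_ord1 eqxx [X in _ + X]big1 ?addr0 => [|j' /negPf jj].
      by rewrite mxE.
    by rewrite big_ord1 jj mul0r mulr0.
  rewrite (bigD1 j) //= big_ord1 eqxx [X in _ + X]big1 ?addr0 => [|j' /negPf jj].
    by rewrite mxE.
  by rewrite big_ord1 jj expr0n.
have := sq.1 (M, b) (0, - b).
rewrite (_ : (M, b) + (0, - b) = (M, 0)); last first.
  by apply: injective_projections; rewrite /= ?addr0 ?subrr.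
rewrite restr qb.
have -> : - \sum_x (- b) 0 x * w x = \sum_x w x * a x ^+ 2.
  by rewrite -sumrN; apply: eq_bigr => x _; rewrite !mxE mulNr opprK mulrC.
under eq_bigr do under eq_bigr do rewrite [X in _ * X]mxE mulrA.
lra.
Qed.

Lemma adversary_matrix_norm_gt0 (G : 'M[R]_d) : adversary_matrix f G -> G != 0 ->
  0 < \big[Num.max/0]_(j < n) spectral_norm (map2_mx *%R G (Delta R D j)).
Proof.
move=> [_ Gf] G0; set m := \big[_/_]_(j < n) _.
have m0 : 0 <= m by rewrite /m; apply: bigmax_ge_id.
rewrite lt_neqAle m0 andbT; apply: contraNneq G0 => m_eq0.
apply/eqP/matrixP => x y; rewrite mxE; apply/eqP; rewrite -normr_le0 m_eq0.
have [fxy|/bit_neq [j jP]] := eqVneq (fv x) (fv y); first by rewrite Gf // normr0.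
apply: le_trans (le_bigmax _ _ j); apply: le_trans (spectral_norm_ge _ x y).
by rewrite !mxE; move: jP; rewrite /bit => ->; rewrite mulr1.
Qed.

(** Dividing [G x y] by [r x * r y], where [r^2] is the shifted [w], and symmetrizing yields an
    adversary matrix [H]. Testing on [r] gives [|H| (1 + eta) >= 2 A], while the multiplier
    inequality gives [|H o Delta_j| <= 2]; the ratio is thus at least [A / (1 + eta)]. *)
Theorem dual_value_le_Adv (x y : 'I_d) : fv x -> ~~ fv y ->
  dual_value (const_mx 1) 0 <= Adv R f.
Proof.
move=> fx fy; have A1 := dual_value1_ge1 fx fy.
have [G [w [w0 w1 GA Gle]]] := dual_multipliers.
set A := dual_value _ _ in A1 GA *.
apply/ler_addgt0Pr => e e0.
(* The multipliers w are shifted by eta / d to make them invertible. *)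
pose eta := e / (`|Adv R f| + 1).
have N0 : 0 < `|Adv R f| + 1 by rewrite ltr_wpDl.
have eta0 : 0 < eta by rewrite divr_gt0.
suff : A <= Adv R f * (1 + eta).
  have : Adv R f * eta <= e.
    rewrite /eta mulrCA ler_piMr ?(ltW e0) // ler_pdivrMr // mul1r.
    by have := ler_norm (Adv R f); lra.
  lra.
have d0 : (0 < d%:R :> R) by rewrite ltr0n; case: (d) x0 => // -[].
pose r z := Num.sqrt (w z + eta / d%:R).
have r2 z : r z ^+ 2 = w z + eta / d%:R.
  by rewrite sqr_sqrtr // addr_ge0 // divr_ge0 ?ltW.
have r0 z : 0 < r z by rewrite sqrtr_gt0 ltr_wpDl // divr_gt0.
have rn z : r z != 0 by rewrite gt_eqF.
have rs : \sum_z r z ^+ 2 <= 1 + eta.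
  under eq_bigr do rewrite r2.
  rewrite big_split /= sumr_const card_ord -[_ *+ d]mulr_natr divfK ?gt_eqF //.
  by rewrite lerD2r.
pose H1 : 'M[R]_d :=
  \matrix_(x, y) (if fv x && ~~ fv y then G x y / (r x * r y) else 0).
pose H := H1 + H1^T.
have Hbil (c : 'I_d -> 'I_d -> R) (a b : 'I_d -> R) : (forall x y, c x y = c y x) ->
    \sum_x \sum_y H x y * c x y * (a x * b y) =
    \sum_x \sum_(y | fv x && ~~ fv y) G x y * c x y * (a x / r x * (b y / r y)) +
    \sum_x \sum_(y | fv x && ~~ fv y) G x y * c x y * (b x / r x * (a y / r y)).
  move=> cC.
  have E (a' b' : 'I_d -> R) : \sum_x \sum_y H1 x y * c x y * (a' x * b' y) =
      \sum_x \sum_(y | fv x && ~~ fv y) G x y * c x y * (a' x / r x * (b' y / r y)).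
    apply: eq_bigr => z _; rewrite [RHS]big_mkcond; apply: eq_bigr => t _.
    rewrite mxE; case: ifP => _; last by rewrite !mul0r.
    by field; rewrite !rn.
  rewrite -!E [X in _ = _ + X]exchange_big -big_split; apply: eq_bigr => z _ /=.
  rewrite -big_split; apply: eq_bigr => t _ /=.
  by rewrite [H z t]mxE [H1^T z t]mxE (cC t z); ring.
have Hadv : adversary_matrix f H.
  split; first by rewrite /H linearD /= trmxK addrC.
  by move=> z t fzt; rewrite !mxE fzt !andbN addr0.
have HA : 2%:R * A <= spectral_norm H * (1 + eta).
  have -> : 2%:R * A = \sum_x \sum_y H x y * (r x * r y).
    have := Hbil (fun _ _ => 1) r r (fun _ _ => erefl).
    under eq_bigr do under eq_bigr do rewrite mulr1.
    move=> ->; have -> : forall S : R, S + S = 2%:R * S by move=> S; ring.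
    rewrite -GA; congr (_ * _); apply: eq_bigr => z _; apply: eq_bigr => t _.
    by rewrite !divff // !mulr1.
  apply: le_trans (bilinear_le_spectral_norm H r r) _.
  have := spectral_norm_ge0 H; set L := spectral_norm H => L0.
  have -> : forall S, L / 2%:R * (S + S) = L * S by move=> S; field.
  by rewrite ler_wpM2l.
have Hn0 : H != 0.
  apply: contraTneq HA => ->; rewrite -ltNge.
  have -> : spectral_norm (0 : 'M[R]_d) = 0.
    apply/eqP; rewrite eq_le spectral_norm_ge0 andbT.
    apply: spectral_norm_le_bilinear => // a b; rewrite !mul0r big1 // => z _.
    by rewrite big1 // => t _; rewrite mxE mul0r.
  rewrite mul0r; lra.
have HD : \big[Num.max/0]_(j < n) spectral_norm (map2_mx *%R H (Delta R D j)) <= 2%:R.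
  apply: bigmax_le => // j _; apply: spectral_norm_le_bilinear => // a b.
  pose c x y : R := (bit x j != bit y j)%:R.
  have := Hbil c a b (fun x y => congr1 (fun b : bool => b%:R) _).
  have -> : \sum_x \sum_y map2_mx *%R H (Delta R D j) x y * (a x * b y) =
    \sum_x \sum_y H x y * c x y * (a x * b y).
    by do 2!(apply: eq_bigr => ? _); rewrite !mxE.
  move=> ->; last by move=> z t; rewrite eq_sym.
  (* The form sees [a'] only on positive inputs and [b'] only on negative ones, so both merge into
     one vector [z], to which the quadratic inequality [Gle] applies. *)
  have half (a' b' : 'I_d -> R) :
      \sum_x \sum_(y | fv x && ~~ fv y) G x y * c x y * (a' x / r x * (b' y / r y)) <=
      \sum_x (if fv x then a' x ^+ 2 else b' x ^+ 2).
    pose z x := (if fv x then a' x else b' x) / r x.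
    rewrite (eq_bigr (fun s => \sum_(t | fv s && ~~ fv t)
        G s t * c s t * (z s * z t))) => [|s _]; last first.
      by apply: eq_bigr => t /andP[fs ft]; rewrite /z fs (negPf ft).
    apply: le_trans (Gle j z) _; apply: ler_sum => s _.
    apply: le_trans (_ : _ <= r s ^+ 2 * z s ^+ 2) _.
      by rewrite ler_wpM2r ?sqr_ge0 // r2 lerDl divr_ge0 ?ltW.
    by rewrite -exprMn mulrC divfK //; case: ifP.
  have := half a b; have := half b a.
  suff -> : 2%:R / 2%:R * (\sum_x a x ^+ 2 + \sum_x b x ^+ 2) =
    \sum_x (if fv x then b x ^+ 2 else a x ^+ 2) +
    \sum_x (if fv x then a x ^+ 2 else b x ^+ 2) by lra.
  rewrite divff ?mul1r -?big_split ?pnatr_eq0 //; apply: eq_bigr => z _ /=.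
  by case: ifP; rewrite // addrC.
have m0 := adversary_matrix_norm_gt0 Hadv Hn0.
have : adv_ratio H <= Adv R f.
  by apply: ub_le_sup; [exact: adv_bounded | exists H].
rewrite /adv_ratio ler_pdivrMr // => HAdv.
have : 0 <= Adv R f.
  rewrite -(pmulr_lge0 _ m0); apply: le_trans HAdv; exact: spectral_norm_ge0.
move=> /ler_wpM2l /(_ _ _ HD) /(le_trans HAdv) HAdv2.
have : spectral_norm H * (1 + eta) <= Adv R f * 2%:R * (1 + eta).
  by rewrite ler_wpM2r // addr_ge0 // ltW.
lra.
Qed.

(** The factor 2 avoids the question whether the infimum is attained: the infimum is at most
    [Adv R f], which is at least 1, so some feasible value lies strictly below twice [Adv R f]. *)
Lemma dual_solution (x y : 'I_d) : fv x -> ~~ fv y ->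
  1 <= Adv R f /\
  exists (K : finType) (u : 'I_d -> 'I_n -> K -> R),
    (forall x y : 'I_d, fv x -> ~~ fv y ->
       \sum_j \sum_k (bit x j != bit y j)%:R * (u x j k * u y j k) = 1) /\
    (forall x, \sum_j \sum_k u x j k ^+ 2 <= 2%:R * Adv R f).
Proof.
move=> fx fy; have A1 := dual_value1_ge1 fx fy; have AA := dual_value_le_Adv fx fy.
split; first exact: le_trans A1 AA.
have /inf_lt : inf [set t | dual_feasible (const_mx 1) 0 t]%classic < 2%:R * Adv R f.
  rewrite -/(dual_value _ _); lra.
case=> [|t [K [u [uM ub]]] tA]; first exact: dual_feasible_ex.
exists K, u; split=> [x' y' fx' fy'|x']; first by rewrite uM // mxE.
by apply: le_trans (ub x') _; rewrite mxE add0r ltW.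
Qed.

End Duality.

(** * Real inner products of complex states *)

Section RealInnerProduct.
Variable R : realType.
Local Notation C := R[i].
Local Open Scope sesquilinear_scope.

(** The real part of the Hermitian inner product, restricted to the coordinates in [P]; being real,
    it can be weighted by a real adversary matrix. *)
Definition rdot (N : nat) (P : pred 'I_N) (p q : 'cV[C]_N) : R :=
  \sum_(k | P k) (complex.Re (p k 0) * complex.Re (q k 0) +
                  complex.Im (p k 0) * complex.Im (q k 0)).

Lemma rdotE N (p q : 'cV[C]_N) :
  rdot predT p q = complex.Re ((p^t* *m q) 0 0).
Proof.
rewrite mxE raddf_sum; apply: eq_bigr => k _; rewrite !mxE.
by case: (p k 0) (q k 0) => a b [c e] /=; ring.
Qed.

Lemma rdot_ge0 N P (p : 'cV[C]_N) : 0 <= rdot P p p.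
Proof. by apply: sumr_ge0 => k _; rewrite addr_ge0 // -expr2 sqr_ge0. Qed.

Lemma sqnorm_rdot N (p : 'cV[C]_N) : sqnorm p = (rdot predT p p)%:C%C.
Proof.
rewrite raddf_sum; apply: eq_bigr => k _ /=.
by rewrite -!expr2 -add_Re2_Im2.
Qed.

Lemma sqnormE_mx N (p : 'cV[C]_N) : sqnorm p = (p^t* *m p) 0 0.
Proof.
by rewrite mxE; apply: eq_bigr => k _; rewrite normCK !mxE mulrC.
Qed.

Lemma unitary_mulVmx N (U : 'M[C]_N) : U \is unitarymx -> U^t* *m U = 1%:M.
Proof. by move=> Uu; rewrite -invmx_unitary // mulVmx // unitarymx_unit. Qed.

Lemma gram_unitary N (U : 'M[C]_N) (p q : 'cV[C]_N) : U \is unitarymx ->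
  (U *m p)^t* *m (U *m q) = p^t* *m q.
Proof.
move=> Uu; rewrite trmx_mul map_mxM /= mulmxA -(mulmxA _ _ U).
by rewrite unitary_mulVmx // mulmx1.
Qed.

Lemma sqnorm_unitary N (U : 'M[C]_N) (p : 'cV[C]_N) : U \is unitarymx ->
  sqnorm (U *m p) = sqnorm p.
Proof. by move=> Uu; rewrite !sqnormE_mx gram_unitary. Qed.

Lemma gram_measurement N (M : bool -> 'M[C]_N) (p q : 'cV[C]_N) :
  \sum_b (M b)^t* *m M b = 1%:M ->
  \sum_b (M b *m p)^t* *m (M b *m q) = p^t* *m q.
Proof.
move=> M1; rewrite -[in RHS](mulmx1 (p^t*)) -M1 mulmx_sumr mulmx_suml.
by apply: eq_bigr => b _; rewrite trmx_mul map_mxM /= !mulmxA.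
Qed.

End RealInnerProduct.

(** * The lower bound on the number of queries *)

Section LowerBound.
Variables (R : realType) (n : nat) (D : {set cube n}) (f : domain D -> bool).
Local Notation C := R[i].
Local Notation d := #|domain D|.
Local Notation fv x := (f (enum_val x)).
Local Notation inp x := (val (enum_val x)).

Lemma bilinear_family_le (K : finType) (A : 'M[R]_d) (al be : 'I_d -> K -> R) :
  \sum_x \sum_y A x y * \sum_k al x k * be y k <=
  spectral_norm A / 2%:R *
    (\sum_x \sum_k al x k ^+ 2 + \sum_x \sum_k be x k ^+ 2).
Proof.
under eq_bigr do under eq_bigr do rewrite mulr_sumr.
under eq_bigr do rewrite exchange_big.
rewrite exchange_big [X in _ * (X + _)]exchange_big [X in _ * (_ + X)]exchange_big /=.
rewrite -big_split mulr_sumr; apply: ler_sum => k _.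
exact: bilinear_le_spectral_norm.
Qed.

(** Real and imaginary parts of all entries become the coordinates of real vectors, to which the
    bilinear bound applies one coordinate at a time. *)
Lemma rdot_family_le (N : nat) (P : pred 'I_N) (A : 'M[R]_d) (a b : 'I_d -> R)
    (p q : 'I_d -> 'cV[C]_N) :
  \sum_x \sum_y A x y * (a x * b y * rdot P (p x) (q y)) <=
  spectral_norm A / 2%:R * (\sum_x a x ^+ 2 * rdot P (p x) (p x) +
                            \sum_x b x ^+ 2 * rdot P (q x) (q x)).
Proof.
pose rc (c : R) (v : 'cV[C]_N) (k : 'I_N * bool) : R :=
  if P k.1 then c * (if k.2 then complex.Im (v k.1 0) else complex.Re (v k.1 0)) else 0.
have E (c c' : R) (v w : 'cV[C]_N) : \sum_k rc c v k * rc c' w k = c * c' * rdot P v w.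
  rewrite -(pair_bigA _ (fun k s => rc c v (k, s) * rc c' w (k, s))) /=.
  rewrite /rdot mulr_sumr [RHS]big_mkcond; apply: eq_bigr => k _.
  by rewrite big_bool /rc /=; case: ifP => _; ring.
have := bilinear_family_le A (fun x => rc (a x) (p x)) (fun x => rc (b x) (q x)).
have E2 (c : R) (v : 'cV[C]_N) : \sum_k rc c v k ^+ 2 = c ^+ 2 * rdot P v v.
  by rewrite expr2 -E; apply: eq_bigr => k _; rewrite expr2.
under eq_bigr do under eq_bigr do rewrite E.
by under [X in _ * (X + _)]eq_bigr do rewrite E2;
   under [X in _ * (_ + X)]eq_bigr do rewrite E2.
Qed.

Lemma oracleE (W : finType) (x : cube n) (p : 'cV[C]_#|basis n W|) k :
  (oracle R W x *m p) k 0 = p (enum_rank (query x (enum_val k))) 0.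
Proof.
have qK : involutive (query (W := W) x).
  by move=> [[i b] w]; rewrite /query addbA addbb.
rewrite mxE (bigD1 (enum_rank (query x (enum_val k)))) //= big1 ?addr0.
  by rewrite mxE enum_rankK qK eqxx mul1r.
move=> l lk; rewrite mxE; case: eqP => [kl|]; last by rewrite mul0r.
by case/eqP: lk; rewrite kl qK enum_valK.
Qed.

Lemma oracle_unitary (W : finType) (x : cube n) : oracle R W x \is unitarymx.
Proof.
have qK : involutive (query (W := W) x).
  by move=> [[i b] w]; rewrite /query addbA addbb.
exact: (basis_op_unitary R qK qK).
Qed.

Definition at_index (W : finType) (i : 'I_n) : pred 'I_#|basis n W| :=
  [pred k | (enum_val k).1.1 == i].

Lemma rdot_split (W : finType) (p q : 'cV[C]_#|basis n W|) :
  rdot predT p q = \sum_i rdot (at_index i) p q.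
Proof. by rewrite /rdot (partition_big (fun k => (enum_val k).1.1) predT). Qed.

(** On the block with query index [i] both oracles act as the same permutation of basis vectors. *)
Lemma rdot_oracle (W : finType) (i : 'I_n) (x y : cube n) (p q : 'cV[C]_#|basis n W|) :
  x i = y i ->
  rdot (at_index i) (oracle R W x *m p) (oracle R W y *m q) = rdot (at_index i) p q.
Proof.
move=> xy; pose h k := enum_rank (query x (enum_val (k : 'I_#|basis n W|))).
have hK : involutive h.
  move=> k; rewrite /h enum_rankK; case E : (enum_val k) => [[i' b] w].
  by rewrite /query addbA addbb -E enum_valK.
rewrite /rdot [RHS](reindex_inj (can_inj hK)) /=; apply: eq_big => k.
  by rewrite /at_index /h /= enum_rankK; case: (enum_val k) => [[i' b] w].
move=> /eqP ki; rewrite !oracleE.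
have -> : enum_rank (query y (enum_val k)) = h k.
  by rewrite /h; move: ki; case: (enum_val k) => [[i' b] w] /= ->; rewrite xy.
by [].
Qed.

(** When the states are split by query index [j], the blocks with [x_j = y_j] cancel and only
    [G o Delta_j] remains. The states before and after the query each contribute at most [m / 2],
    because the squared norms of the blocks sum to 1. *)
Lemma oracle_progress (W : finType) (G : 'M[R]_d) (m : R) (a b : 'I_d -> R)
    (p : 'I_d -> 'cV[C]_#|basis n W|) :
  (forall j, spectral_norm (map2_mx *%R G (Delta R D j)) <= m) ->
  (forall x, rdot predT (p x) (p x) = 1) ->
  \sum_x \sum_y G x y * (a x * b y * rdot predT (p x) (p y)) <=
  \sum_x \sum_y G x y * (a x * b y *
     rdot predT (oracle R W (inp x) *m p x) (oracle R W (inp y) *m p y)) +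
  m * (\sum_x a x ^+ 2 + \sum_x b x ^+ 2).
Proof.
move=> Gm p1; pose q x := oracle R W (inp x) *m p x.
have q1 x : rdot predT (q x) (q x) = 1.
  by rewrite rdotE gram_unitary ?oracle_unitary // -rdotE.
pose GD j := map2_mx *%R G (Delta R D j).
rewrite -lerBlDl -sumrB.
have -> : \sum_x (\sum_y G x y * (a x * b y * rdot predT (p x) (p y)) -
      \sum_y G x y * (a x * b y * rdot predT (q x) (q y))) =
    \sum_j (\sum_x \sum_y GD j x y * (a x * b y * rdot (at_index j) (p x) (p y)) +
     \sum_x \sum_y GD j x y * (- a x * b y * rdot (at_index j) (q x) (q y))).
  under [RHS]eq_bigr do rewrite -big_split /=.
  rewrite exchange_big; apply: eq_bigr => x _ /=.
  under [RHS]eq_bigr do rewrite -big_split /=.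
  rewrite exchange_big -sumrB; apply: eq_bigr => y _ /=.
  rewrite !rdot_split !mulr_sumr -sumrB; apply: eq_bigr => j _.
  rewrite !mxE; case: eqP => [xy|_] /=; last by rewrite mulr1; ring.
  by rewrite (rdot_oracle _ _ xy); ring.
have S (r : 'I_d -> 'cV[C]_#|basis n W|) (c : 'I_d -> R) :
    (forall x, rdot predT (r x) (r x) = 1) ->
    \sum_j \sum_x c x ^+ 2 * rdot (at_index j) (r x) (r x) = \sum_x c x ^+ 2.
  move=> r1; rewrite exchange_big; apply: eq_bigr => x _ /=.
  by rewrite -mulr_sumr -rdot_split r1 mulr1.
have T (r : 'I_d -> 'cV[C]_#|basis n W|) (c e : 'I_d -> R) :
    (forall x, rdot predT (r x) (r x) = 1) ->
    \sum_j \sum_x \sum_y GD j x y * (c x * e y * rdot (at_index j) (r x) (r y)) <=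
    m / 2%:R * (\sum_x c x ^+ 2 + \sum_x e x ^+ 2).
  move=> r1; rewrite -(S r c r1) -(S r e r1) -big_split mulr_sumr.
  apply: ler_sum => j _; apply: le_trans (rdot_family_le _ _ _ _ _ _) _.
  rewrite ler_wpM2r ?ler_pM2r ?invr_gt0 ?Gm // addr_ge0 // sumr_ge0 // => x _;
    by rewrite mulr_ge0 ?sqr_ge0 ?rdot_ge0.
rewrite big_split /=.
have := T q (fun x => - a x) b q1.
have -> : \sum_x (- a x) ^+ 2 = \sum_x a x ^+ 2.
  by apply: eq_bigr => x _; rewrite sqrrN.
have := T p a b p1; lra.
Qed.

Lemma final_progress (N : nat) (G : 'M[R]_d) (a b : 'I_d -> R)
    (p : 'I_d -> 'cV[C]_N) (M : bool -> 'M[C]_N) :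
  adversary_matrix f G ->
  (\sum_b (M b)^t* *m M b = 1%:M)%sesqui ->
  (forall x, rdot predT (p x) (p x) = 1) ->
  (forall x, 2%:R / 3%:R <= rdot predT (M (fv x) *m p x) (M (fv x) *m p x)) ->
  \sum_x \sum_y G x y * (a x * b y * rdot predT (p x) (p y)) <=
  17%:R / 36%:R * spectral_norm G * (\sum_x a x ^+ 2 + \sum_x b x ^+ 2).
Proof.
move=> [_ Gf] M1 p1 pM.
pose r x := M (fv x) *m p x; pose e x := M (~~ fv x) *m p x.
have split2 x y : rdot predT (p x) (p y) =
    rdot predT (M (fv x) *m p x) (M (fv x) *m p y) +
    rdot predT (M (~~ fv x) *m p x) (M (~~ fv x) *m p y).
  rewrite rdotE -(gram_measurement _ _ M1) big_bool /= mxE raddfD /= -!rdotE.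
  by case: (fv x); [reflexivity | exact: addrC].
have e1 x : rdot predT (e x) (e x) = 1 - rdot predT (r x) (r x).
  by have := split2 x x; rewrite p1 -/(r x) -/(e x); lra.
(* If [f x <> f y], an outcome that is right for one input is wrong for the other. The weight 5/6
   goes to right outcomes and 6/5 to wrong ones; their product is 1, and they push the sum of
   weighted squared norms below 1. *)
have -> : \sum_x \sum_y G x y * (a x * b y * rdot predT (p x) (p y)) =
   \sum_x \sum_y G x y *
     (5%:R / 6%:R * a x * (6%:R / 5%:R * b y) * rdot predT (r x) (e y)) +
   \sum_x \sum_y G x y *
     (6%:R / 5%:R * a x * (5%:R / 6%:R * b y) * rdot predT (e x) (r y)).
  rewrite -big_split; apply: eq_bigr => x _ /=.
  rewrite -big_split; apply: eq_bigr => y _ /=.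
  have [fxy|fxy] := eqVneq (fv x) (fv y); first by rewrite Gf // !mul0r addr0.
  rewrite split2 /r /e; have -> : fv y = ~~ fv x.
    by move: fxy; case: (fv x); case: (fv y).
  by rewrite negbK; field.
apply: le_trans (lerD (rdot_family_le _ _ _ _ _ _) (rdot_family_le _ _ _ _ _ _)) _.
rewrite -mulrDr -mulrA [leRHS]mulrCA -[spectral_norm G / _ * _]mulrA.
apply: ler_wpM2l; first exact: spectral_norm_ge0.
(* 25/36 p + 36/25 (1 - p) <= 17/18 for p >= 2/3 *)
have half (c : 'I_d -> R) :
    \sum_x (5%:R / 6%:R * c x) ^+ 2 * rdot predT (r x) (r x) +
    \sum_x (6%:R / 5%:R * c x) ^+ 2 * rdot predT (e x) (e x) <=
    17%:R / 18%:R * \sum_x c x ^+ 2.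
  rewrite -big_split mulr_sumr; apply: ler_sum => x _ /=; rewrite e1.
  set P := rdot _ _ _; have : 2%:R / 3%:R <= P by exact: pM.
  move=> hP; have : 0 <= c x ^+ 2 * (P - 2%:R / 3%:R).
    by rewrite mulr_ge0 ?sqr_ge0 // subr_ge0.
  by have := sqr_ge0 (c x); lra.
have arith (x1 x2 y1 y2 X Z : R) :
    x1 + x2 <= 17%:R / 18%:R * X -> y1 + y2 <= 17%:R / 18%:R * Z ->
    2%:R^-1 * (x1 + y2 + (x2 + y1)) <= 17%:R / 36%:R * (X + Z) by lra.
exact: arith (half a) (half b).
Qed.

Lemma Adv_le_queries (T : nat) : computable_with R f T -> Adv R f <= 36%:R * T%:R.
Proof.
move=> [A Acomp].
pose E := [set adv_ratio G |
  G in [set G : 'M[R]_d | adversary_matrix f G /\ G != 0]]%classic.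
rewrite /Adv -/E.
have [->|/set0P E0] := eqVneq E set0; first by rewrite sup0 mulr_ge0.
apply: ge_sup => // _ [G [Gadv G0] <-].
have m0 := adversary_matrix_norm_gt0 Gadv G0.
set m := \big[_/_]_(j < n) _ in m0.
have Gm j : spectral_norm (map2_mx *%R G (Delta R D j)) <= m by exact: le_bigmax.
rewrite /adv_ratio -/m ler_pdivrMr //.
pose psi t (x : 'I_d) := final_state A (inp x) t : 'cV[C]_#|basis n (alg_work A)|.
have psi1 t x : rdot predT (psi t x) (psi t x) = 1.
  have : sqnorm (psi t x) = 1.
    elim: t => [|t IH]; rewrite /psi /= sqnorm_unitary ?alg_unitaryP ?alg_initP //.
    by rewrite sqnorm_unitary ?oracle_unitary.
  by rewrite sqnorm_rdot => /(congr1 (@complex.Re _)).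
(* This rearranges to [|G| / 18 <= 2 T m], the source of the constant 36. *)
suff : spectral_norm G <= 17%:R / 18%:R * spectral_norm G + 2%:R * T%:R * m by lra.
apply: spectral_norm_le_bilinear => [|a b].
  have := spectral_norm_ge0 G; have : 0 <= T%:R * m by rewrite mulr_ge0 // ltW.
  lra.
pose prog t := \sum_x \sum_y G x y * (a x * b y * rdot predT (psi t x) (psi t y)).
set S := \sum_x a x ^+ 2 + _.
have step t : prog 0%N <= prog t + t%:R * m * S.
  elim: t => [|t IH]; first by rewrite !mul0r addr0.
  apply: le_trans IH _; rewrite -natr1 !mulrDl mul1r addrA [leRHS]addrAC lerD2r.
  apply: le_trans (oracle_progress a b Gm (psi1 t)) _.
  rewrite lerD2r le_eqVlt; apply/orP; left; apply/eqP.
  apply: eq_bigr => x _; apply: eq_bigr => y _.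
  by rewrite [in RHS]rdotE /psi /= gram_unitary ?alg_unitaryP // -rdotE.
have -> : \sum_x \sum_y G x y * (a x * b y) = prog 0%N.
  apply: eq_bigr => x _; apply: eq_bigr => y _.
  have -> : psi 0%N y = psi 0%N x by [].
  by rewrite psi1 mulr1.
apply: le_trans (step T) _.
have : prog T <= 17%:R / 36%:R * spectral_norm G * S.
  apply: final_progress Gadv (alg_measP A) (psi1 T) _ => x.
  have := Acomp (enum_val x); rewrite /output_prob sqnorm_rdot.
  rewrite -lecR; congr (_ <= _); by rewrite rmorphM fmorphV !rmorph_nat.
have -> : (17%:R / 18%:R * spectral_norm G + 2%:R * T%:R * m) / 2%:R * S =
  17%:R / 36%:R * spectral_norm G * S + T%:R * m * S by field.
by rewrite lerD2r.
Qed.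

End LowerBound.

Section ClockRegister.
Variables (R : realType) (n : nat) (T : nat) (Y : finType).
Local Notation C := R[i].
Local Open Scope sesquilinear_scope.
Local Notation W := (('I_T * Y)%type : finType).
Local Notation N := #|basis n Y|.
Local Notation NT := #|basis n W|.

Definition clock_of (k : 'I_NT) : 'I_T := (enum_val k).2.1.

Definition state_of (k : 'I_NT) : 'I_N :=
  let: (i, b, (_, y)) := enum_val k in enum_rank (i, b, y).

Definition clock_index (t : 'I_T) (m : 'I_N) : 'I_NT :=
  let: (i, b, y) := enum_val m in enum_rank (i, b, (t, y)).

Lemma clock_of_index t m : clock_of (clock_index t m) = t.
Proof.
rewrite /clock_of /clock_index.
by case: (enum_val m) => [[i b] y]; rewrite enum_rankK.
Qed.

Lemma state_of_index t m : state_of (clock_index t m) = m.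
Proof.
rewrite /state_of /clock_index; case E : (enum_val m) => [[i b] y].
by rewrite enum_rankK -E enum_valK.
Qed.

Lemma clock_indexK k : clock_index (clock_of k) (state_of k) = k.
Proof.
rewrite /clock_of /state_of /clock_index.
case E : (enum_val k) => [[i b] [t y]]; rewrite enum_rankK /=.
by rewrite -E enum_valK.
Qed.

Lemma clock_sum (V : nmodType) (h : 'I_NT -> V) :
  \sum_k h k = \sum_t \sum_m h (clock_index t m).
Proof.
rewrite pair_bigA /= (reindex (fun p => clock_index p.1 p.2)) //.
exists (fun k => (clock_of k, state_of k)) => [[t m] _|k _] /=.
  by rewrite clock_of_index state_of_index.
exact: clock_indexK.
Qed.

(** This is [sum_t |t> g_t], with an unnormalized clock. *)
Definition clock_vec (g : 'I_T -> 'cV[C]_N) : 'cV[C]_NT :=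
  \col_k g (clock_of k) (state_of k) 0.

(** The block-diagonal operator [sum_t |t><t| B_t]: the clock controls which [B_t] is applied. *)
Definition clock_op (B : 'I_T -> 'M[C]_N) : 'M[C]_NT :=
  \matrix_(k, l)
    ((clock_of k == clock_of l)%:R * B (clock_of k) (state_of k) (state_of l)).

Lemma clock_op_vec B g : clock_op B *m clock_vec g = clock_vec (fun t => B t *m g t).
Proof.
apply/colP => k; rewrite !mxE clock_sum (bigD1 (clock_of k)) //=.
rewrite [X in _ + X]big1 ?addr0 => [|t tk].
  by apply: eq_bigr => m _; rewrite !mxE clock_of_index state_of_index eqxx mul1r.
rewrite big1 // => m _.
by rewrite !mxE clock_of_index eq_sym (negPf tk) !mul0r.
Qed.

Lemma clock_op_unitary B : (forall t, B t \is unitarymx) -> clock_op B \is unitarymx.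
Proof.
move=> Bu; apply/unitarymxP/matrixP => k l; rewrite !mxE clock_sum.
rewrite (bigD1 (clock_of k)) //= [X in _ + X]big1 ?addr0 => [|t tk]; last first.
  rewrite big1 // => m _.
  by rewrite !mxE clock_of_index eq_sym (negPf tk) !mul0r.
transitivity ((clock_of l == clock_of k)%:R *
    (B (clock_of k) *m (B (clock_of l))^t*) (state_of k) (state_of l)).
  rewrite mxE mulr_sumr; apply: eq_bigr => m _; rewrite !mxE.
  by rewrite clock_of_index state_of_index eqxx mul1r rmorphM /= conjC_nat mulrCA.
case: eqP => [lk|lk]; last first.
  by rewrite mul0r; case: eqP => // kl; case: lk; rewrite kl.
rewrite lk mul1r (unitarymxP (Bu _)) mxE; congr (_%:R); congr nat_of_bool.
apply/eqP/eqP => [st|-> //].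
by rewrite -(clock_indexK k) -(clock_indexK l) lk st.
Qed.

Lemma oracle_clock_vec x g :
  oracle R W x *m clock_vec g = clock_vec (fun t => oracle R Y x *m g t).
Proof.
apply/colP => k; rewrite oracleE [LHS]mxE [RHS]mxE oracleE /clock_of /state_of enum_rankK.
by case: (enum_val k) => [[i b] [t y]] /=; rewrite enum_rankK.
Qed.

Lemma sqnorm_clock_vec g : sqnorm (clock_vec g) = \sum_t sqnorm (g t).
Proof.
rewrite /sqnorm clock_sum; apply: eq_bigr => t _; apply: eq_bigr => m _.
by rewrite mxE clock_of_index state_of_index.
Qed.

(** The projector onto the uniform superposition of clock values, tensored with the identity. *)
Definition clock_mean : 'M[C]_NT :=
  \matrix_(k, l) (T%:R^-1 * (state_of k == state_of l)%:R).

Lemma clock_mean_vec g :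
  clock_mean *m clock_vec g = clock_vec (fun _ => T%:R^-1 *: \sum_t g t).
Proof.
apply/colP => k; rewrite !mxE clock_sum summxE mulr_sumr; apply: eq_bigr => t _.
rewrite (bigD1 (state_of k)) //= big1 ?addr0 => [|m mk].
  by rewrite !mxE clock_of_index state_of_index eqxx mulr1.
by rewrite !mxE state_of_index eq_sym (negPf mk) mulr0 mul0r.
Qed.

Lemma clock_mean_adj : clock_mean^t* = clock_mean.
Proof.
by apply/matrixP => k l; rewrite !mxE rmorphM fmorphV /= !conjC_nat eq_sym.
Qed.

Lemma clock_mean_idem : (0 < T)%N -> clock_mean *m clock_mean = clock_mean.
Proof.
move=> T0; apply/matrixP => k l; rewrite !mxE clock_sum.
rewrite (eq_bigr (fun _ => T%:R^-1 * T%:R^-1 * (state_of k == state_of l)%:R)).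
  rewrite sumr_const card_ord -[LHS]mulr_natl !mulrA divff ?mul1r //.
  by rewrite pnatr_eq0 -lt0n.
move=> t _; rewrite (bigD1 (state_of k)) //= big1 ?addr0 => [|m mk].
  by rewrite !mxE state_of_index eqxx mulr1 mulrA.
by rewrite !mxE state_of_index eq_sym (negPf mk) mulr0 mul0r.
Qed.

Definition clock_meas (b : bool) : 'M[C]_NT :=
  if b then clock_mean else 1%:M - clock_mean.

Lemma clock_measP : (0 < T)%N -> \sum_b (clock_meas b)^t* *m clock_meas b = 1%:M.
Proof.
move=> T0; have adj : (1%:M - clock_mean)^t* = 1%:M - clock_mean.
  apply/matrixP => k l; rewrite !mxE rmorphB rmorphM fmorphV /= !conjC_nat.
  by rewrite eq_sym (eq_sym (state_of k)).
rewrite big_bool /= adj clock_mean_adj clock_mean_idem //.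
rewrite mulmxBl mul1mx mulmxBr mulmx1 clock_mean_idem // subrr subr0.
by rewrite addrC subrK.
Qed.

End ClockRegister.

(** * Averaging an orbit by means of the clock *)

Section PhaseDetection.
Variables (R : realType) (n : nat) (T : nat) (Y : finType).
Local Notation C := R[i].
Local Open Scope sesquilinear_scope.
Local Notation W := (('I_T * Y)%type : finType).
Local Notation N := #|basis n Y|.

Hypothesis T_gt0 : (0 < T)%N.
Variables (S : 'M[C]_N) (e : 'cV[C]_N).
Hypothesis S_unitary : S \is unitarymx.
Hypothesis e_unit : sqnorm e = 1.
Hypothesis e_fixed : forall x, oracle R Y x *m e = e.

Definition walk (x : cube n) (t : nat) : 'cV[C]_N :=
  iter t (fun v => oracle R Y x *m (S *m v)) e.

Definition clock_scale : C := ((Num.sqrt T%:R)^-1)%:C%C.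

Lemma sqnormZ m (c : C) (v : 'cV[C]_m) : sqnorm (c *: v) = `|c| ^+ 2 * sqnorm v.
Proof.
by rewrite /sqnorm mulr_sumr; apply: eq_bigr => k _; rewrite mxE normrM exprMn.
Qed.

Lemma clock_scale_sqr : `|clock_scale| ^+ 2 = T%:R^-1.
Proof.
rewrite -add_Re2_Im2 /= expr0n addr0 exprVn sqr_sqrtr //.
by rewrite fmorphV rmorph_nat.
Qed.

Let TC_neq0 : (T%:R : C) != 0.
Proof. by rewrite pnatr_eq0 -lt0n. Qed.

Definition clock_init : 'cV[C]_#|basis n W| :=
  clock_vec (fun _ : 'I_T => clock_scale *: e).

Lemma clock_initP : sqnorm clock_init = 1.
Proof.
rewrite sqnorm_clock_vec sumr_const card_ord sqnormZ e_unit clock_scale_sqr.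
by rewrite mulr1 -[LHS]mulr_natl divff.
Qed.

(* Branch t of the clock waits, with the oracle acting trivially on e, until
   only t queries are left. *)
Definition branch_step (s : nat) (t : 'I_T) : 'M[C]_N :=
  if (T - t <= s < T)%N then S else 1%:M.

Lemma branch_step_unitary s : clock_op (branch_step s) \is unitarymx.
Proof.
apply: clock_op_unitary => t; rewrite /branch_step.
case: ifP => _; first exact: S_unitary.
by apply/unitarymxP; rewrite trmx1 map_mx1 mulmx1.
Qed.

Definition clock_algorithm : query_algorithm R n :=
  QueryAlgorithm clock_initP branch_step_unitary (clock_measP R n Y T_gt0).

(** Branch [t] has walked [s - (T - t)] steps, where truncated subtraction gives 0 while it waits.
    The unitary that follows query [s] stays in front, since its [S] belongs to the next walk
    step. *)
Lemma final_state_clock x s : (s <= T)%N ->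
  final_state clock_algorithm x s =
  clock_op (branch_step s) *m
    clock_vec (fun t : 'I_T => clock_scale *: walk x (s - (T - t))).
Proof.
elim: s => [_|s IH sT].
  rewrite /= /clock_init; congr (_ *m _); congr clock_vec.
rewrite /= IH ?(ltnW sT) //; congr (_ *m _).
rewrite clock_op_vec oracle_clock_vec; congr clock_vec; apply: funext => t.
rewrite -!scalemxAr; congr (_ *: _); rewrite /branch_step sT andbT.
case: leqP => ts; first by rewrite subSn //.
rewrite mul1mx; have -> : (s.+1 - (T - t) = 0)%N by apply/eqP; rewrite subn_eq0.
have -> : (s - (T - t) = 0)%N by apply/eqP; rewrite subn_eq0 ltnW.
exact: e_fixed.
Qed.

(** After [T] queries branch [t] has walked exactly [t] steps and the last unitary is trivial.
    Projecting the clock leaves [T] equal copies of the average, and this factor cancels the squared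
    normalization [1 / T]. *)
Lemma output_prob_clock x :
  output_prob clock_algorithm x T true = sqnorm (T%:R^-1 *: \sum_(t < T) walk x t).
Proof.
rewrite /output_prob final_state_clock // clock_op_vec /= clock_mean_vec.
rewrite sqnorm_clock_vec sumr_const card_ord.
rewrite (eq_bigr (fun t : 'I_T => clock_scale *: walk x t)) => [|t _].
  rewrite -scaler_sumr scalerA mulrC -scalerA sqnormZ clock_scale_sqr.
  by rewrite -[LHS]mulr_natl mulrA divff ?mul1r.
by rewrite /branch_step ltnn andbF mul1mx subKn // ltnW.
Qed.

Lemma output_prob_compl (A : query_algorithm R n) x s :
  output_prob A x s true + output_prob A x s false = 1.
Proof.
have : sqnorm (final_state A x s) = 1.
  elim: s => [|s IH] /=; rewrite sqnorm_unitary ?alg_unitaryP ?alg_initP //.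
  by rewrite sqnorm_unitary ?oracle_unitary.
rewrite sqnormE_mx -(gram_measurement _ _ (alg_measP A)) big_bool /= mxE.
by rewrite -!sqnormE_mx.
Qed.

End PhaseDetection.

(** * A criterion for computability with [T] queries *)

Section Criterion.
Variables (R : realType) (n : nat) (D : {set cube n}) (f : domain D -> bool).
Local Notation C := R[i].
Local Notation rd := (rdot predT).

Lemma rdotDl N (p p' q : 'cV[C]_N) : rd (p + p') q = rd p q + rd p' q.
Proof.
rewrite -big_split; apply: eq_bigr => k _; rewrite mxE !raddfD /=; ring.
Qed.

Lemma rdotC N (p q : 'cV[C]_N) : rd p q = rd q p.
Proof. by apply: eq_bigr => k _; rewrite mulrC [X in _ + X]mulrC. Qed.

Lemma rdotDr N (p q q' : 'cV[C]_N) : rd p (q + q') = rd p q + rd p q'.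
Proof. by rewrite rdotC rdotDl !(rdotC p). Qed.

Lemma rdotZr N (c : R) (p q : 'cV[C]_N) : rd p (c%:C%C *: q) = c * rd p q.
Proof.
rewrite mulr_sumr; apply: eq_bigr => k _; rewrite mxE.
by case: (q k 0) => a b /=; ring.
Qed.

Lemma rdotZl N (c : R) (p q : 'cV[C]_N) : rd (c%:C%C *: p) q = c * rd p q.
Proof. by rewrite rdotC rdotZr rdotC. Qed.

Lemma rdotN N (p q : 'cV[C]_N) : rd (- p) q = - rd p q.
Proof. by rewrite -scaleN1r (_ : -1 = (-1)%:C%C) ?rdotZl ?mulN1r // rmorphN rmorph1. Qed.

Lemma rdot_sqB N (p q : 'cV[C]_N) :
  rd (p - q) (p - q) = rd p p - 2%:R * rd p q + rd q q.
Proof.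
rewrite rdotDl !rdotDr !rdotN !(rdotC _ (- q)) !rdotN (rdotC q p); ring.
Qed.

Lemma rdot_unitary N (U : 'M[C]_N) (p q : 'cV[C]_N) : U \is unitarymx ->
  rd (U *m p) (U *m q) = rd p q.
Proof. by move=> Uu; rewrite !rdotE gram_unitary. Qed.

(* A positive instance is accepted because e overlaps a fixed point of U = O S;
   a negative one is rejected because e is a coboundary psi - U psi, so that the
   orbit sums of e telescope and no spectral gap is needed. *)
Lemma computable_phase_detection (T : nat) (Y : finType)
    (S : 'M[C]_#|basis n Y|) (e : 'cV[C]_#|basis n Y|) :
  (0 < T)%N -> S \is unitarymx -> sqnorm e = 1 ->
  (forall x, oracle R Y x *m e = e) ->
  (forall x : domain D, f x -> exists t,
     [/\ oracle R Y (val x) *m (S *m t) = t, rd t e = 1 & rd t t <= 3%:R / 2%:R]) ->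
  (forall x : domain D, ~~ f x -> exists psi,
     psi - oracle R Y (val x) *m (S *m psi) = e /\ 12%:R * rd psi psi <= T%:R ^+ 2) ->
  computable_with R f T.
Proof.
move=> T0 Su e1 ee pos neg.
exists (clock_algorithm T0 Su e1) => x.
have := output_prob_compl (clock_algorithm T0 Su e1) (val x) T.
have TR : (0 < T%:R :> R) by rewrite ltr0n.
have Uu z v w : rd (oracle R Y z *m (S *m v)) (oracle R Y z *m (S *m w)) = rd v w.
  by rewrite !rdot_unitary ?oracle_unitary.
have c23 : (2%:R / 3%:R : C) = (2%:R / 3%:R : R)%:C%C.
  by rewrite rmorphM fmorphV !rmorph_nat.
pose V := (T%:R^-1 : C) *: \sum_(t < T) walk S e (val x) t.
have pt : output_prob (clock_algorithm T0 Su e1) (val x) T true = (rd V V)%:C%C.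
  by rewrite output_prob_clock // sqnorm_rdot.
have Tc : (T%:R^-1 : C) = (T%:R^-1 : R)%:C%C by rewrite fmorphV rmorph_nat.
case: (boolP (f x)) => [/pos [t [Ut te tt]]|/neg [psi [psie psiT]]] pc.
  rewrite pt c23 lecR.
  have tV : rd t V = 1.
    (* As [t] is fixed by the unitary [U], [<t, U^s e> = <U^s t, U^s e> = <t, e>]. *)
    have tw s : rd t (walk S e (val x) s) = 1.
      by elim: s => [//|s IH]; rewrite -{1}Ut /walk /= Uu.
    rewrite /V Tc rdotZr.
    have -> : rd t (\sum_(s < T) walk S e (val x) s) = T%:R.
      rewrite -[in RHS](card_ord T) -sumr_const; elim/big_rec2: _ => [|s a b _ IH].
        by rewrite -(scale0r (0 : 'cV[C]__)) (rdotZr 0) mul0r.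
      by rewrite rdotDr IH tw.
    by rewrite mulVf // gt_eqF.
  (* Expanding the square gives [|V|^2 >= 4/3 - 4/9 |t|^2 >= 4/3 - 2/3 = 2/3]. *)
  have := rdot_ge0 predT (V - (2%:R / 3%:R : R)%:C%C *: t).
  rewrite rdot_sqB !rdotZl !rdotZr (rdotC V t) tV; lra.
have -> : output_prob (clock_algorithm T0 Su e1) (val x) T false = (1 - rd V V)%:C%C.
  by rewrite rmorphB rmorph1 /= -pt -pc addrC addKr.
rewrite c23 lecR.
suff : rd V V <= 1 / 3%:R by lra.
pose U s := iter s (fun v => oracle R Y (val x) *m (S *m v)) psi.
have UU s : rd (U s) (U s) = rd psi psi by elim: s => [//|s IH]; rewrite /U /= Uu.
have -> : V = (T%:R^-1)%:C%C *: (psi - U T).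
  rewrite /V Tc; congr (_ *: _).
  have wU s : walk S e (val x) s = U s - U s.+1.
    elim: s => [|s IH]; first by rewrite -[LHS]/e -psie.
    by rewrite /walk iterS -/(walk S e (val x) s) IH !mulmxBr.
  have tele s : \sum_(t < s) walk S e (val x) t = psi - U s.
    elim: s => [|s IH]; first by rewrite big_ord0 subrr.
    by rewrite big_ord_recr /= IH wU addrA subrK.
  exact: tele.
have bound : rd (psi - U T) (psi - U T) <= 4%:R * rd psi psi.
  (* By the parallelogram law, after dropping [|psi + U^T psi|^2]. *)
  have := rdot_ge0 predT (psi - - U T).
  rewrite !rdot_sqB !(rdotC _ (- U T)) !rdotN (rdotC _ (- U T)) rdotN.
  rewrite UU (rdotC (U T) psi); lra.
rewrite rdotZl rdotZr mulrA -invfM mulrC ler_pdivrMr ?mulr_gt0 //.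
move: psiT; rewrite expr2; lra.
Qed.

End Criterion.

(** * Orthogonal projectors and reflections *)

Section Projector.
Variable C : numClosedFieldType.
Local Open Scope sesquilinear_scope.

(** Gram-Schmidt on the rows of the conjugate transpose of [A] gives an orthonormal [Q], and [P] is
    the conjugate transpose of [Q] times [Q]: the projector onto the column space of [A]. *)
Lemma orthogonal_projector N m (A : 'M[C]_(N, m)) : exists P : 'M[C]_N,
  [/\ P^t* = P, P *m P = P, P *m A = A &
      forall v : 'cV[C]_N, A^t* *m v = 0 -> P *m v = 0].
Proof.
pose U := A^t*; pose Q := schmidt (row_base U).
have QQ : Q *m Q^t* = 1%:M.
  by apply/unitarymxP; rewrite schmidt_unitarymx // rank_leq_col.
have QU : (Q :=: U)%MS.
  by apply: eqmx_trans (eq_row_base U); apply: eqmx_schmidt_free; rewrite row_base_free.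
exists (Q^t* *m Q); split.
- by rewrite trmx_mul map_mxM /= trmxCK.
- by rewrite mulmxA -(mulmxA _ Q) QQ mulmx1.
- have /submxP [c Uc] : (U <= Q)%MS by rewrite QU.
  have AQ : A = Q^t* *m c^t*.
    by rewrite -[LHS]trmxCK -[A^t*]/U [in LHS]Uc trmx_mul map_mxM.
  by rewrite [X in _ *m X]AQ mulmxA -(mulmxA _ Q) QQ mulmx1 -AQ.
- have /submxP [c Qc] : (Q <= U)%MS by rewrite QU.
  move=> v Uv; have Qv : Q *m v = 0 by rewrite [X in X *m _]Qc -mulmxA Uv mulmx0.
  by rewrite -mulmxA Qv mulmx0.
Qed.

Lemma reflection_unitary N (P : 'M[C]_N) : P^t* = P -> P *m P = P ->
  1%:M - 2%:R *: P \is unitarymx.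
Proof.
move=> PP P2; apply/unitarymxP.
have -> : (1%:M - 2%:R *: P)^t* = 1%:M - 2%:R *: P.
  apply/matrixP => k l; rewrite !mxE rmorphB rmorphM /= !conjC_nat eq_sym.
  by rewrite -[in RHS]PP !mxE.
rewrite mulmxBl mul1mx mulmxBr mulmx1 -scalemxAl -scalemxAr P2 scalerA.
apply/matrixP => k l; rewrite !mxE; ring.
Qed.

End Projector.

(** * The algorithm built from a dual solution *)

Section SpanProgram.
Variables (R : realType) (n : nat) (i0 : 'I_n) (K : finType).
Local Notation C := R[i].
Local Notation Y := (('I_1 + bool * K)%type : finType).
Local Open Scope sesquilinear_scope.

(** The division by [sqrt 2] normalizes |+> and |->, the sign [(-1)^b] is that of |->, and the
    arbitrary query index [i0] hosts |0>. *)
Definition program_amp (c : R) (w : 'I_n -> bool -> K -> R) (s : basis n Y) : R :=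
  match s.2 with
  | inl _ => c * (s.1.1 == i0)%:R
  | inr (a, k) => (-1) ^+ s.1.2 * w s.1.1 a k
  end / Num.sqrt 2%:R.

(* The vector c |0> + sum_(i, a, k) w i a k |i, a, k>, where |0> puts the output
   bit of the oracle in the state |+> and |i, a, k> puts it in |->. *)
Definition program_vec c w : 'cV[C]_#|basis n Y| :=
  \col_k (program_amp c w (enum_val k))%:C%C.

Lemma rdot_program c w c' w' :
  rdot predT (program_vec c w) (program_vec c' w') =
  c * c' + \sum_i \sum_a \sum_k w i a k * w' i a k.
Proof.
pose g s := program_amp c w s * program_amp c' w' s.
have s22 : Num.sqrt 2%:R * Num.sqrt 2%:R = 2%:R :> R by rewrite -expr2 sqr_sqrtr.
have half z z' : z / Num.sqrt 2%:R * (z' / Num.sqrt 2%:R) = z * z' / 2%:R :> R.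
  by rewrite mulrACA -invfM s22.
have -> : rdot predT (program_vec c w) (program_vec c' w') = \sum_s g s.
  transitivity (\sum_(s in (basis n Y : finType)) g s); last exact: eq_bigl.
  by rewrite big_enum_val; apply: eq_bigr => k _; rewrite !mxE /= mulr0 addr0.
rewrite -(pair_bigA _ (fun p y => g (p, y))) /=.
rewrite -(pair_bigA _ (fun i b => \sum_y g (i, b, y))) /=.
have -> : c * c' = \sum_i c * c' * (i == i0)%:R.
  by rewrite -mulr_sumr (bigD1 i0) //= eqxx big1 ?addr0 ?mulr1 // => i /negPf ->.
rewrite -big_split; apply: eq_bigr => i _ /=; rewrite big_bool /= !big_sumType !big_ord1.
rewrite addrACA (pair_bigA _ (fun a k => w i a k * w' i a k)) -big_split /=.
congr (_ + _); last first.
  by apply: eq_bigr => -[a k] _; rewrite /g /program_amp /= !half; field.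
by rewrite /g /program_amp /= !half; case: eqP => _ /=; field.
Qed.

Lemma gram_program c w c' w' :
  ((program_vec c w)^t* *m program_vec c' w') 0 0 =
  (c * c' + \sum_i \sum_a \sum_k w i a k * w' i a k)%:C%C.
Proof.
rewrite -rdot_program mxE raddf_sum; apply: eq_bigr => k _; rewrite !mxE /=.
by rewrite mulr0 addr0 [RHS]rmorphM conj_Creal ?complex_real /=.
Qed.

Lemma program_vecD c w c' w' : program_vec c w + program_vec c' w' =
  program_vec (c + c') (fun i a k => w i a k + w' i a k).
Proof.
apply/colP => k; rewrite !mxE -rmorphD; congr (_%:C%C); rewrite /program_amp.
by case: (enum_val k) => [[i b] [j|[a k']]] /=; ring.
Qed.

Definition sign_flip : 'M[C]_#|basis n Y| :=
  diag_mx (\row_k if (enum_val k).2 is inr (true, _) then -1 else 1).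

Lemma sign_flip_unitary : sign_flip \is unitarymx.
Proof.
apply/unitarymxP; rewrite tr_diag_mx map_diag_mx mulmx_diag.
apply/matrixP => k l; rewrite !mxE; congr (_ *+ _).
by case: (enum_val k) => [s [j|[[] k']]] /=; rewrite ?rmorphN rmorph1 ?mulrNN mulr1.
Qed.

(** Phase kickback on |-> contributes [(-1)^(x_i)] and the flip contributes [(-1)^a]. Together they
    form a reflection fixing |0> and the |i, a, k> with [a = x_i], and negating those with
    [a <> x_i]. *)
Lemma oracle_program (x : cube n) c w :
  oracle R Y x *m (sign_flip *m program_vec c w) =
  program_vec c (fun i a k => (-1) ^+ (a (+) x i) * w i a k).
Proof.
apply/colP => k; rewrite oracleE mul_diag_mx !mxE enum_rankK /program_amp.
case: (enum_val k) => [[i b] [j|[a k']]] /=; first by rewrite mul1r.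
rewrite !signr_addb; case: a; rewrite ?mul1r ?mulN1r -?rmorphN; congr (_%:C%C);
  rewrite ?expr0 ?expr1; ring.
Qed.

Lemma oracle_program0 (x : cube n) c :
  oracle R Y x *m program_vec c (fun _ _ _ => 0) = program_vec c (fun _ _ _ => 0).
Proof.
apply/colP => k; rewrite oracleE !mxE enum_rankK /program_amp.
by case: (enum_val k) => [[i b] [j|[a k']]] /=; rewrite ?mulr0.
Qed.

Lemma program_vec_ext c w w' : (forall i a k, w i a k = w' i a k) ->
  program_vec c w = program_vec c w'.
Proof. by move=> ww; congr program_vec; do 3!(apply: funext => ?). Qed.

Variables (D : {set cube n}) (f : domain D -> bool).
Local Notation d := #|domain D|.
Local Notation fv x := (f (enum_val x)).
Variables (A : R) (u : 'I_d -> 'I_n -> K -> R).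
Hypothesis A_gt0 : 0 < A.
Hypothesis u_one : forall x y : 'I_d, fv x -> ~~ fv y ->
  \sum_j \sum_k (bit x j != bit y j)%:R * (u x j k * u y j k) = 1.
Hypothesis u_norm : forall x, \sum_j \sum_k u x j k ^+ 2 <= A.

(* This scale gives |witness1 x|^2 <= 3/2 and <witness1 x, e> = 1, hence
   acceptance probability at least 2/3. *)
Let al := Num.sqrt (2%:R * A)^-1.

Let al_sqr : al ^+ 2 = (2%:R * A)^-1.
Proof. by rewrite sqr_sqrtr // invr_ge0 mulr_ge0 // ltW. Qed.

Let al_gt0 : 0 < al.
Proof. by rewrite sqrtr_gt0 invr_gt0 mulr_gt0. Qed.

(** Supported on |0> and on [a = x_i], hence fixed by the reflection of the input [x]. *)
Definition witness1 (x : 'I_d) :=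
  program_vec 1 (fun i a k => (a == bit x i)%:R * (al * u x i k)).

(** Outside |0> the support is [a <> x_i], which the reflection of [x] negates: adding the reflected
    vector leaves twice the |0> part, namely [e]. The scale cancels that of [witness1]. *)
Definition witness0 (x : 'I_d) :=
  program_vec 2%:R^-1 (fun i a k => (a != bit x i)%:R * (- (2%:R * al)^-1 * u x i k)).

(** The |0> parts contribute 1/2. The other parts overlap only at indices where [x] and [y] differ,
    and the constraint [u_one] makes that contribution -1/2. *)
Lemma witness_orthogonal (x y : 'I_d) : fv x -> ~~ fv y ->
  ((witness0 y)^t* *m witness1 x) 0 0 = 0.
Proof.
move=> fx fy; rewrite gram_program mulr1.
have -> : \sum_i \sum_a \sum_k (a != bit y i)%:R * (- (2%:R * al)^-1 * u y i k) *
   ((a == bit x i)%:R * (al * u x i k)) = - 2%:R^-1; last by rewrite subrr.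
rewrite -[RHS]mulr1 -[X in _ = _ * X](u_one fx fy) mulr_sumr; apply: eq_bigr => i _.
rewrite exchange_big mulr_sumr; apply: eq_bigr => k _ /=; rewrite big_bool /=.
have an : al != 0 by rewrite gt_eqF.
by case: (bit x i); case: (bit y i) => /=; field.
Qed.

Lemma witness1_norm x : rdot predT (witness1 x) (witness1 x) <= 3%:R / 2%:R.
Proof.
rewrite rdot_program.
have -> : \sum_i \sum_a \sum_k (a == bit x i)%:R * (al * u x i k) *
   ((a == bit x i)%:R * (al * u x i k)) = (2%:R * A)^-1 * \sum_i \sum_k u x i k ^+ 2.
  rewrite -al_sqr mulr_sumr; apply: eq_bigr => i _.
  rewrite exchange_big mulr_sumr; apply: eq_bigr => k _ /=; rewrite big_bool /=.
  by case: (bit x i) => /=; ring.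
have : (2%:R * A)^-1 * (\sum_i \sum_k u x i k ^+ 2) <= (2%:R * A)^-1 * A.
  by rewrite ler_pM2l // invr_gt0 mulr_gt0.
have -> : (2%:R * A)^-1 * A = 2%:R^-1 by field; rewrite gt_eqF.
lra.
Qed.

Lemma witness0_norm x :
  rdot predT (witness0 x) (witness0 x) <= (1 + 2%:R * A ^+ 2) / 4%:R.
Proof.
rewrite rdot_program.
have -> : \sum_i \sum_a \sum_k (a != bit x i)%:R * (- (2%:R * al)^-1 * u x i k) *
   ((a != bit x i)%:R * (- (2%:R * al)^-1 * u x i k)) =
   A / 2%:R * \sum_i \sum_k u x i k ^+ 2.
  have -> : A / 2%:R = (2%:R * al)^-1 ^+ 2.
    by rewrite exprVn exprMn al_sqr; field; rewrite gt_eqF.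
  rewrite mulr_sumr; apply: eq_bigr => i _.
  rewrite exchange_big mulr_sumr; apply: eq_bigr => k _ /=; rewrite big_bool /=.
  by case: (bit x i) => /=; ring.
have : A / 2%:R * (\sum_i \sum_k u x i k ^+ 2) <= A / 2%:R * A.
  by rewrite ler_pM2l // divr_gt0.
rewrite expr2; lra.
Qed.

(** The second reflection negates the span of the negative witnesses and fixes its orthogonal
    complement, which contains every positive witness. The condition on [T] is 12 times the bound of
    [witness0_norm], as the criterion asks. *)
Lemma span_program_computable (T : nat) : (0 < T)%N ->
  3%:R + 6%:R * A ^+ 2 <= T%:R ^+ 2 -> computable_with R f T.
Proof.
move=> T0 TA.
pose M : 'M[C]_(#|basis n Y|, d) := \matrix_(k, y) (if fv y then 0 else witness0 y k 0).
have [P [PP P2 PM P0]] := orthogonal_projector M.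
pose S := sign_flip *m (1%:M - 2%:R *: P).
have SE v : S *m v = sign_flip *m (v - 2%:R *: (P *m v)).
  by rewrite /S -mulmxA mulmxBl mul1mx -scalemxAl.
have bitE (x : domain D) i : bit (enum_rank x) i = val x i by rewrite /bit enum_rankK.
apply: (@computable_phase_detection _ _ _ _ _ _ S (program_vec 1 (fun _ _ _ => 0))) => //.
- by rewrite mul_unitarymx ?sign_flip_unitary ?reflection_unitary.
- rewrite sqnorm_rdot rdot_program mulr1 big1 ?addr0 // => i _.
  by rewrite big1 // => a _; rewrite big1 // => k _; rewrite mulr0.
- by move=> x; exact: oracle_program0.
- move=> x fx; exists (witness1 (enum_rank x)); split; last exact: witness1_norm.
    rewrite SE P0; last first.
      apply/colP => y; rewrite !mxE; case: (boolP (fv y)) => fy.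
        by rewrite big1 // => k _; rewrite !mxE fy rmorph0 mul0r.
      have := @witness_orthogonal (enum_rank x) y; rewrite enum_rankK fx => /(_ isT fy).
      rewrite [LHS]mxE => wt; rewrite -[RHS]wt; apply: eq_bigr => k _.
      by rewrite !mxE (negPf fy).
    rewrite scaler0 subr0 oracle_program; apply: program_vec_ext => i a k.
    by rewrite bitE; case: eqP => [->|_]; rewrite ?addbb ?mul1r // !mul0r mulr0.
  rewrite rdot_program mulr1 big1 ?addr0 // => i _.
  by rewrite big1 // => a _; rewrite big1 // => k _; rewrite mulr0.
move=> x fx; exists (witness0 (enum_rank x)); split; last first.
  by have := witness0_norm (enum_rank x); lra.
have -> : S *m witness0 (enum_rank x) = - (sign_flip *m witness0 (enum_rank x)).
  rewrite SE; have -> : P *m witness0 (enum_rank x) = witness0 (enum_rank x).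
    have := congr1 (col (enum_rank x)) PM; rewrite [LHS]colE -mulmxA -colE.
    have -> : col (enum_rank x) M = witness0 (enum_rank x).
      by apply/colP => k; rewrite !mxE enum_rankK (negPf fx).
    by [].
  by rewrite -mulmxN; congr (_ *m _); rewrite scaler_nat mulr2n opprD addrA subrr sub0r.
rewrite mulmxN oracle_program opprK.
rewrite program_vecD; have -> : 2%:R^-1 + 2%:R^-1 = 1 :> R by field.
apply: program_vec_ext => i a k; rewrite bitE.
by case: a; case: (val x i) => /=; ring.
Qed.

End SpanProgram.

(** * Degenerate cases and the two inequalities *)

Lemma ord_n0 (n : nat) : n = 0%N -> 'I_n -> False.
Proof. by move=> -> []. Qed.

Section QueryComplexity.
Variables (R : realType) (n : nat) (D : {set cube n}) (f : domain D -> bool).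
Local Notation C := R[i].

Lemma Q_le (T : nat) : computable_with R f T -> (Q R f <= T)%N.
Proof.
move=> fT; rewrite /Q; case: xgetP => [T' _ [_ Tmin]|//]; exact: Tmin.
Qed.

(** Without query indices the state space is zero-dimensional and contains no unit initial vector;
    [Q] then takes its default value 0. *)
Lemma not_computable_n0 T : n = 0%N -> ~ computable_with R f T.
Proof.
move=> n0 [A _]; have := alg_initP A; rewrite /sqnorm big1 => [|k _].
  by move/eqP; rewrite eq_sym oner_eq0.
by case: (enum_val k) => [[/(ord_n0 n0)]].
Qed.

Lemma Q_n0 : n = 0%N -> Q R f = 0%N.
Proof.
by move=> n0; rewrite /Q; case: xgetP => // T _ [/(not_computable_n0 n0)].
Qed.

Lemma const_computable (c : bool) : (0 < n)%N -> (forall x, f x = c) ->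
  computable_with R f 0.
Proof.
move=> n0 fc.
pose M (b : bool) : 'M[C]_#|basis n unit| := if b == c then 1%:M else 0.
have M1 : (\sum_b (M b)^t* *m M b = 1%:M)%sesqui.
  rewrite big_bool /M; case: (c) => /=.
    by rewrite mulmx0 addr0 trmx1 map_mx1 mulmx1.
  by rewrite mulmx0 add0r trmx1 map_mx1 mulmx1.
pose v : 'cV[C]_#|basis n unit| := ket R ((Ordinal n0, false, tt) : basis n unit).
have v1 : sqnorm v = 1.
  rewrite /sqnorm (bigD1 (enum_rank ((Ordinal n0, false, tt) : basis n unit))) //=.
  rewrite !mxE !eqxx normr1 expr1n big1 ?addr0 // => k /negPf kv.
  by rewrite mxE kv normr0 expr0n.
have U1 (t : nat) : (1%:M : 'M[C]_#|basis n unit|) \is unitarymx.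
  by apply/unitarymxP; rewrite trmx1 map_mx1 mulmx1.
exists (QueryAlgorithm v1 U1 M1) => x; rewrite /output_prob /= fc /M eqxx !mul1mx v1.
by rewrite ler_pdivrMr ?ltr0n // mul1r ler_nat.
Qed.

Lemma Q_const (c : bool) : (forall x, f x = c) -> Q R f = 0%N.
Proof.
move=> fc; have [n0|n0] := posnP n; first exact: Q_n0.
by apply/eqP; rewrite -leqn0; apply: Q_le; exact: const_computable fc.
Qed.

Lemma Adv_const (c : bool) : (forall x, f x = c) -> Adv R f = 0.
Proof.
move=> fc; rewrite /Adv [X in sup X](_ : _ = set0) ?sup0 //.
apply/seteqP; split=> [r [G [[_ G0] /eqP Gn0] _]|r []]; case: Gn0.
by apply/matrixP => x y; rewrite mxE G0 // !fc.
Qed.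

Lemma Adv_le_Q : Adv R f <= 36%:R * (Q R f)%:R.
Proof.
have [n0|n0] := posnP n; last exact/Adv_le_queries/computable_with_Q.
(* For [n = 0] the domain has at most one point, so [f] is constant. *)
suff fc x : f x = (if [pick y] is Some y then f y else false).
  by rewrite (Adv_const fc) mulr_ge0.
case: pickP => [y _|/(_ x) //]; congr f; apply: val_inj; apply/ffunP => i.
by case: (ord_n0 n0 i).
Qed.

Lemma Q_le_Adv : (Q R f)%:R <= 9%:R * Adv R f.
Proof.
have [/existsP [x fx]|/existsPn h] := boolP [exists x, f x]; last first.
  have fc x : f x = false by apply/negbTE/h.
  by rewrite (Q_const fc) (Adv_const fc) mulr0.
have [/existsP [y fy]|/existsPn h] := boolP [exists y, ~~ f y]; last first.
  have fc y : f y = true by apply/negbNE/h.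
  by rewrite (Q_const fc) (Adv_const fc) mulr0.
have n_gt0 : (0 < n)%N.
  rewrite lt0n; apply: contraNneq fy => n0; rewrite -(_ : x = y) //.
  apply: val_inj; apply/ffunP => i; case: (ord_n0 n0 i).
have [||A1 [K [u [u1 uA]]]] :=
  @dual_solution R n D f (enum_rank x) (enum_rank x) (enum_rank y).
- by rewrite enum_rankK.
- by rewrite enum_rankK.
set A := Adv R f in A1 uA *.
(* The query count is [T = 3 m] with [m > 2 A]. As [2 A >= 2], this gives
   [3 + 6 (2 A)^2 <= 9 (2 A)^2 <= T^2]. *)
pose m := (Num.truncn (2%:R * A)).+1.
have /andP[mA Am] : (Num.truncn (2%:R * A))%:R <= 2%:R * A < m%:R.
  by apply: truncn_itv; lra.
have A2 : 0 < 2%:R * A by lra.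
have T3 : (0 < 3 * m)%N by [].
have : computable_with R f (3 * m)%N.
  apply: (span_program_computable (Ordinal n_gt0) A2 u1 uA T3).
  rewrite natrM; set M := m%:R in Am *; nra.
move=> /Q_le; rewrite -(ler_nat R) => /le_trans; apply.
(* Here [3 m <= 3 (2 A + 1) <= 9 A], by [1 <= A]. *)
rewrite natrM /m -natr1; lra.
Qed.

End QueryComplexity.

Theorem theorem1p3 (R : realType) :
  exists c1 c2 : R, [/\ 0 < c1, 0 < c2 &
    forall (n : nat) (D : {set cube n}) (f : domain D -> bool),
      c1 * Adv R f <= (Q R f)%:R <= c2 * Adv R f].
Proof.
exists 36%:R^-1, 9%:R; split; rewrite ?invr_gt0 // => n D f.
by rewrite Q_le_Adv ler_pdivrMl ?Adv_le_Q.
Qed.
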